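(* A pre-QTM $M$ (as in the context) is a QTM (i.e. $\delta_0$ satisfies the local unitary conditions (U1)–(U3)) if and only if its time evolution operator $U_M$ is unitary.
   Context: Fix a finite tape alphabet $\Sigma$ containing $1$ and $\Box$ (blank); to each $a\in\Sigma$ associate an extra symbol $\bar a$, $\bar\Sigma=\{\bar a\}$, $\tilde\Sigma=\Sigma\cup\bar\Sigma$, $\mathbb D=\{L,R\}$. $\ell^2(I)$ denotes square-summable complex functions on a countable set $I$, $|c\rangle$ the indicator of $c$. A pre-QTM is a tuple $M=\langle\Sigma,Q,Q_s,Q_t,\delta,q_i,q_f\rangle$: $Q$ finite, disjoint $Q_s,Q_t\subseteq Q$, $q_i\in Q_s$, $q_f\in Q_t$, $Q_0=Q\setminus(Q_s\cup Q_t)$; with $S_0=(Q_0\cup Q_s)\times\Sigma$, $S_s=Q_s\times\bar\Sigma$, $S_t=Q_t\times\Sigma$, $T_0=(Q_0\cup Q_t)\times\Sigma$, $T_s=Q_s\times\Sigma$, $T_t=Q_t\times\bar\Sigma$, $\delta=\delta_0\cup\delta_s\cup\delta_t$, $\delta_x:S_x\to\ell^2(T_x\times\mathbb D)$, where $\delta_s(q,\bar a)$ is the indicator of $(q,a,R)$, $\delta_t(q,a)$ is the indicator of $(q,\bar a,R)$, and $\delta_0:S_0\to\ell^2(T_0\times\mathbb D)$ is arbitrary. The local unitary conditions are: (U1) $\sum_{(p,b,d)\in T_0\times\mathbb D}|\delta_0(q,a)(p,b,d)|^2=1$ for all $(q,a)\in S_0$; (U2) $\sum_{(p,b,d)\in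 T_0\times\mathbb D}\overline{\delta_0(q',a')(p,b,d)}\delta_0(q,a)(p,b,d)=0$ for distinct $(q,a),(q',a')\in S_0$; (U3) $\sum_{p\in Q_0\cup Q_t}\overline{\delta_0(q',a')(p,b',L)}\delta_0(q,a)(p,b,R)=0$ for all $(q,a,b),(q',a',b')\in(Q_0\cup Q_s)\times\Sigma^2$. Configurations are triples $\langle\alpha,q,\beta\rangle\in\tilde\Sigma^*\times Q\times\tilde\Sigma^*$ up to blank padding on the left of $\alpha$ and right of $\beta$ (head on first symbol of $\beta$, blank if $\beta$ empty), with: $q\in Q_0\Rightarrow\alpha\beta\in\Sigma^*$; $q\in Q_s\Rightarrow\alpha\in\Sigma^*,\beta\in\bar\Sigma^*\Sigma^*$; $q\in Q_t\Rightarrow\beta\in\Sigma^*,\alpha\in\Sigma^*\bar\Sigma^*$; $\mathfrak C_M$ is their set. With $\gamma(\langle\alpha w,q,u\beta\rangle,p,v,R)=\langle\alpha wv,p,\beta\rangle$, $\gamma(\langle\alpha w,q,u\beta\rangle,p,v,L)=\langle\alpha,p,wv\beta\rangle$, define for $C=\langle\alpha,q,u\beta\rangle$ with $(q,u)\in S_x$: $W_M|C\rangle=\sum_{(p,v,d)\in T_x\times\mathbb D}\delta_x(q,u)(p,v,d)|\gamma(C,p,v,d)\rangle$, extended linearly to the span of $\{|C\rangle\}$; the time evolution operator $U_M$ is its unique bounded extension to $\ell^2(\mathfrak C_M)$.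
   Formalization: The formal theorem adds the hypothesis |Q_t| ≤ |Q_s|, without which the equivalence fails (Q_s={q_i}, Q_t={q_f,q_g}, Q_0 empty, δ_0(q_i,a)=|q_f,a,R⟩ satisfies (U1)–(U3) but U_M is not surjective); 1 and □ are taken to be distinct. *)

(* Defs.v *)
From HB Require Import structures.
From mathcomp Require Import all_boot all_order all_algebra.
From mathcomp Require Import finmap complex.
From mathcomp Require Import mathcomp_extra boolp classical_sets functions.
From mathcomp Require Import cardinality fsbigop reals ereal numfun esum.
From mathcomp Require Import ring lra.

Set Implicit Arguments.
Unset Strict Implicit.
Unset Printing Implicit Defensive.

Import Order.TTheory GRing.Theory Num.Theory.
Import ComplexField.Normc.

Local Open Scope classical_set_scope.
Local Open Scope ring_scope.
Local Open Scope complex_scope.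

Section SquareSummable.
Context {R : realType} {I : choiceType}.
Implicit Types f g : I -> R[i]^o.

Definition sqsum f : \bar R :=
  \esum_(i in [set: I]) (normc (f i) ^+ 2)%:E.

Definition square_summable f : bool := `[< (sqsum f < +oo)%E >].

Lemma normc_ge0 (z : R[i]) : 0 <= normc z.
Proof. by case: z => x y; exact: sqrtr_ge0. Qed.

Lemma sqsum_ge0 f : (0 <= sqsum f)%E.
Proof. by apply: esum_ge0 => i _; rewrite lee_fin sqr_ge0. Qed.

Lemma sqsum0 : sqsum 0 = 0%E.
Proof. by apply: esum1 => i _; rewrite normc0 expr0n. Qed.

Lemma esumZl (k : R) (a : I -> R) : 0 <= k -> (forall i, 0 <= a i) ->
  (\esum_(i in [set: I]) (k * a i)%:E <=
   k%:E * \esum_(i in [set: I]) (a i)%:E)%E.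
Proof.
move=> k0 a0; apply: ge_ereal_sup => _ [X [finX _]] <-.
rewrite fsbig_finite//=.
under eq_bigr do rewrite EFinM.
rewrite -ge0_sume_distrr; last by move=> i _; rewrite lee_fin.
apply: lee_pmul => //; first by apply: sume_ge0 => i _; rewrite lee_fin.
apply: esum_ge; exists X => //; by rewrite fsbig_finite.
Qed.

Lemma sqsumD f g : (sqsum (f + g)%R <= 2%:E * (sqsum f + sqsum g))%E.
Proof.
have h i : normc ((f + g) i) ^+ 2 <= 2 * (normc (f i) ^+ 2 + normc (g i) ^+ 2).
  rewrite fctE; set a := normc (f i); set b := normc (g i).
  have ab : normc (f i + g i) <= a + b by exact: le_normcD.
  apply: (@le_trans _ _ ((a + b) ^+ 2)).
    by rewrite ler_sqr ?nnegrE ?addr_ge0 ?normc_ge0.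
  by have := sqr_ge0 (a - b); nra.
apply: (@le_trans _ _ (\esum_(i in [set: I])
   (2 * (normc (f i) ^+ 2 + normc (g i) ^+ 2))%:E)).
  by apply: le_esum => i _; rewrite lee_fin h.
apply: le_trans (esumZl _ _) _ => //.
  by move=> i; rewrite addr_ge0 ?sqr_ge0.
rewrite /sqsum -esumD//; by move=> i _; rewrite lee_fin sqr_ge0.
Qed.

Lemma sqsumZ (k : R[i]) f : (sqsum (k *: f) <= (normc k ^+ 2)%:E * sqsum f)%E.
Proof.
have -> : sqsum (k *: f) =
    \esum_(i in [set: I]) (normc k ^+ 2 * normc (f i) ^+ 2)%:E.
  by apply: eq_esum => i _; rewrite fctE /GRing.scale/= normcM exprMn.
by apply: esumZl => [|i]; rewrite sqr_ge0.
Qed.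

Lemma square_summable_submod : submod_closed square_summable.
Proof.
split=> [|k f g /asboolP lf /asboolP lg].
  by apply/asboolP; rewrite sqsum0 ltry.
apply/asboolP; apply: le_lt_trans (sqsumD _ _) _.
rewrite lte_mul_pinfty// ?lee_fin// lte_add_pinfty//.
apply: le_lt_trans (sqsumZ _ _) _.
by rewrite lte_mul_pinfty// lee_fin sqr_ge0.
Qed.

HB.instance Definition _ :=
  GRing.isSubmodClosed.Build _ _ square_summable square_summable_submod.

End SquareSummable.

Record l2 (R : realType) (I : choiceType) := L2
  { l2val :> I -> R[i]^o; _ : l2val \in square_summable }.
HB.instance Definition _ R I := [isSub for @l2val R I].
HB.instance Definition _ R I := [Choice of l2 R I by <:].
HB.instance Definition _ R I := [SubChoice_isSubLmodule of l2 R I by <:].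

Section Hilbert.
Context {R : realType} {I : choiceType}.
Implicit Types (f g : l2 R I) (U V : l2 R I -> l2 R I).

Definition l2norm f : R := Num.sqrt (fine (sqsum f)).

(* Meaningful for absolutely summable families, such as the real and imaginary
   parts of the terms of an inner product. *)
Definition rsum (a : I -> R) : R :=
  fine (\esum_(i in [set: I]) (EFin \o a)^\+ i)%E -
  fine (\esum_(i in [set: I]) (EFin \o a)^\- i)%E.

Definition csum (z : I -> R[i]) : R[i] :=
  rsum (fun i => complex.Re (z i)) +i* rsum (fun i => complex.Im (z i)).

Definition inner f g : R[i] := csum (fun i => (f i)^* * g i).

Definition bounded_linear U : Prop :=
  linear U /\ exists K : R, forall f, l2norm (U f) <= K * l2norm f.

Definition adjoint U V : Prop := forall f g, inner (U f) g = inner f (V g).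

Definition unitary U : Prop :=
  bounded_linear U /\
  exists V, [/\ adjoint U V, cancel U V & cancel V U].

Definition ket_fun (i : I) : I -> R[i]^o := fun j => (j == i)%:R.

Lemma normcb (b : bool) : normc (b%:R : R[i]) ^+ 2 = b%:R.
Proof. by case: b; rewrite ?normc1 ?normc0 ?expr1n ?expr0n. Qed.

Lemma ket_subproof i : ket_fun i \in square_summable.
Proof.
apply/asboolP; rewrite /sqsum.
have -> : \esum_(j in [set: I]) (normc (ket_fun i j) ^+ 2)%:E =
          \esum_(j in [set i]) (1%:E : \bar R).
  rewrite [RHS]esum_mkcond; apply: eq_esum => j _.
  by rewrite in_set1 /ket_fun normcb; case: (j == i).
by rewrite esum_set1 ?lee_fin// ltry.
Qed.

Definition ket i : l2 R I := L2 (ket_subproof i).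

Definition sq_bounded U :=
  exists2 K : R, 0 <= K & forall f, (sqsum (U f) <= K%:E * sqsum f)%E.

Lemma sqsum_fin f : sqsum f \is a fin_num.
Proof.
by rewrite ge0_fin_numE ?sqsum_ge0//; case: f => f /= /asboolP.
Qed.

Lemma sq_bounded_bounded U : sq_bounded U ->
  exists K : R, forall f, l2norm (U f) <= K * l2norm f.
Proof.
move=> [K K0 UK]; exists (Num.sqrt K) => f.
rewrite /l2norm -sqrtrM//; apply: ler_wsqrtr.
rewrite -lee_fin EFinM !fineK ?sqsum_fin//.
Qed.

Lemma bounded_sq_bounded U :
  (exists K : R, forall f, l2norm (U f) <= K * l2norm f) -> sq_bounded U.
Proof.
move=> [K UK]; exists (K ^+ 2) => [|f]; first exact: sqr_ge0.
rewrite -[X in (X <= _)%E]fineK ?sqsum_fin// -[X in (_ * X)%E]fineK ?sqsum_fin//.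
have f0 g : 0 <= fine (sqsum g) by rewrite fine_ge0 ?sqsum_ge0.
rewrite -EFinM lee_fin -[leLHS]sqr_sqrtr// -[X in _ * X]sqr_sqrtr//.
rewrite -exprMn ler_sqr ?nnegrE ?sqrtr_ge0//; first exact: UK.
exact: le_trans (sqrtr_ge0 _) (UK f).
Qed.

Lemma sq_bounded_sum (T : finType) (P : pred T) (c : T -> R[i])
    (U : T -> l2 R I -> l2 R I) :
  (forall k, sq_bounded (U k)) ->
  sq_bounded (fun f => \sum_(k | P k) c k *: U k f).
Proof.
move=> UB; elim: (index_enum T) => [|k r [K K0 IH]].
  by exists 0 => // f; rewrite big_nil /= sqsum0 mul0e.
have [L L0 UL] := UB k.
exists (2 * (normc (c k) ^+ 2 * L + K)).
  by rewrite mulr_ge0// addr_ge0// mulr_ge0// sqr_ge0.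
move=> f; rewrite big_cons.
have fE : sqsum f = (fine (sqsum f))%:E by rewrite fineK ?sqsum_fin.
case: ifPn => Pk; last first.
  apply: le_trans (IH f) _; rewrite fE -!EFinM lee_fin.
  have : 0 <= fine (sqsum f) by rewrite fine_ge0 ?sqsum_ge0.
  have : 0 <= normc (c k) ^+ 2 * L by rewrite mulr_ge0// sqr_ge0.
  by move: (_ * L) => x; move: (fine _) => y; nra.
apply: le_trans (sqsumD _ _) _; rewrite EFinM -muleA lee_pmul2l//.
rewrite EFinD ge0_muleDl ?lee_fin ?mulr_ge0 ?sqr_ge0 ?normc_ge0//.
apply: leeD; last exact: IH.
apply: le_trans (sqsumZ _ _) _; rewrite [(_ * L)%:E]EFinM -muleA.
by apply: lee_pmul; rewrite ?lee_fin ?sqr_ge0 ?sqsum_ge0//; exact: UL.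
Qed.

Section Shift.
Variable s : I -> option I.
Hypothesis s_inj : forall i j k, s i = Some k -> s j = Some k -> i = j.

Definition shift_fun (f : I -> R[i]^o) : I -> R[i]^o :=
  fun i => if s i is Some j then f j else 0.

Lemma sqsum_shift f : (sqsum (shift_fun f) <= sqsum f)%E.
Proof.
pose D : set I := [set i | s i != None].
pose e i := odflt i (s i).
have -> : sqsum (shift_fun f) = \esum_(i in D) (normc (f (e i)) ^+ 2)%:E.
  rewrite [RHS]esum_mkcond; apply: eq_esum => i _.
  rewrite /shift_fun /e; have [/set_mem|/negP] := boolP (i \in D).
    by rewrite /D /=; case: (s i).
  move=> nD; have : ~ D i by move=> /mem_set.
  by rewrite /D /=; case: (s i) => [j []//|_]; rewrite normc0 expr0n.
rewrite -(esum_image D e (fun j => (normc (f j) ^+ 2)%:E)).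
  rewrite esum_mkcond; apply: le_esum => i _.
  by case: ifP => // _; rewrite lee_fin sqr_ge0.
move=> i j /set_mem Di /set_mem Dj; rewrite /e.
move: Di Dj; rewrite /D /=.
case Ei: (s i) => [a|//] _; case Ej: (s j) => [b|//] _ /= ab.
by apply: s_inj Ei _; rewrite Ej ab.
Qed.

Lemma shift_subproof f : shift_fun f \in square_summable.
Proof.
apply/asboolP; apply: le_lt_trans (sqsum_shift f) _.
by case: f => f /= /asboolP.
Qed.

Definition shift f : l2 R I := L2 (shift_subproof f).

Lemma shift_sq_bounded : sq_bounded shift.
Proof. by exists 1 => // f; rewrite mul1e sqsum_shift. Qed.

Lemma shift_linear : linear shift.
Proof.
move=> k f g; apply/val_inj/funext => i; rewrite /= !fctE /shift_fun.
by case: (s i) => [j|]; rewrite ?fctE// scaler0 addr0.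
Qed.

End Shift.

Lemma linear_sum (T : finType) (P : pred T) (c : T -> R[i])
    (U : T -> l2 R I -> l2 R I) : (forall k, linear (U k)) ->
  linear (fun f => \sum_(k | P k) c k *: U k f).
Proof.
move=> lU a f g; rewrite scaler_sumr -big_split /=.
apply: eq_bigr => k _; rewrite lU scalerDr !scalerA; congr (_ *: _ + _).
exact: mulrC.
Qed.

End Hilbert.

Section Density.
Context {R : realType} {I : choiceType}.
Implicit Types (f g : l2 R I) (U V : l2 R I -> l2 R I).

Lemma sqsum_eq0 f : sqsum f = 0%E -> f = 0.
Proof.
move=> f0; apply/val_inj/funext => i /=.
apply: eq0_normc; apply/eqP; rewrite -sqrf_eq0 -eqe eq_le; apply/andP; split.
  have : ((normc (f i) ^+ 2)%:E <= sqsum f)%E.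
    apply: esum_ge; exists [set i]; first by split.
    by rewrite fsbig_set1.
  by rewrite f0.
by rewrite lee_fin sqr_ge0.
Qed.

Lemma l2_sumE (T : Type) (r : seq T) (F : T -> l2 R I) j :
  (\sum_(i <- r) F i) j = \sum_(i <- r) F i j.
Proof. by elim/big_rec2 : _ => [|i x y _ <-]. Qed.

Lemma l2BE f g j : (f - g) j = f j - g j.
Proof. by []. Qed.

Lemma l2ZE (c : R[i]) f j : (c *: f) j = c * f j.
Proof. by []. Qed.

Lemma ket_dense f (e : R) : 0 < e ->
  exists r : seq I, (sqsum (f - \sum_(i <- r) (f i : R[i]) *: ket i)%R <= e%:E)%E.
Proof.
move=> e0; pose a i : \bar R := (normc (f i) ^+ 2)%:E.
have a0 i : (0 <= a i)%E by rewrite lee_fin sqr_ge0.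
have [_ [X [finX _] <-] hX] := ub_ereal_sup_adherent e0 (sqsum_fin f).
exists (fset_set X); set g := (f - _)%R.
have gE j : g j = if j \in X then 0 else f j.
  rewrite /g l2BE l2_sumE.
  have -> : (\sum_(i <- fset_set X) ((f i : R[i]) *: ket i) j) =
     \sum_(i <- fset_set X) (if i == j then f j else 0).
    apply: eq_bigr => i _; rewrite l2ZE /= /ket_fun eq_sym.
    by case: eqP => [->|_]; rewrite ?mulr1 ?mulr0.
  have [jX|jX] := boolP (j \in X).
    rewrite (bigD1_seq j) ?fset_uniq ?in_fset_set//= eqxx big1 ?addr0 ?subrr//.
    by move=> i /negPf ->.
  rewrite big_seq big1 ?subr0// => i; rewrite in_fset_set// => iX.
  by case: eqP => // ij; move: jX; rewrite -ij iX.
have -> : sqsum g = \esum_(i in [set: I] `&` ~` X) a i.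
  rewrite setTI [RHS]esum_mkcond; apply: eq_esum => j _.
  by rewrite gE in_setC; case: (j \in X); rewrite ?normc0 ?expr0n.
have := esumID X [set: I] a (fun i _ => a0 i).
rewrite setTI (esum_fset finX (fun i _ => a0 i)) -/(sqsum f) => fE.
have pfin : (\sum_(i \in X) a i)%E \is a fin_num.
  by rewrite fsbig_finite//=; apply/sum_fin_numP.
have {}hX : (sqsum f - e%:E < \sum_(i \in X) a i)%E by [].
move: hX; rewrite fE.
have : ((\esum_(i in [set: I] `&` ~` X) a i)%E \is a fin_num).
  have := sqsum_fin f; rewrite fE fin_numD => /andP[_]; exact.
move: pfin; case: (\sum_(i \in X) a i)%E => [x||]// _.
case: (esum _ _) => [y||]// _; rewrite -!EFinD lte_fin lee_fin; lra.
Qed.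

Lemma bounded_linear_unique U V : bounded_linear U -> bounded_linear V ->
  (forall i, U (ket i) = V (ket i)) -> U = V.
Proof.
move=> [lU /bounded_sq_bounded[K K0 UK]] [lV /bounded_sq_bounded[L L0 VL]] UV.
apply/funext => f; apply/eqP; rewrite -subr_eq0; apply/eqP.
have U0 : U 0 = 0.
  by have := lU 1 0 0; rewrite scaler0 addr0 scale1r => /eqP; rewrite -subr_eq0 opprD addrA subrr sub0r oppr_eq0 => /eqP.
have V0 : V 0 = 0.
  by have := lV 1 0 0; rewrite scaler0 addr0 scale1r => /eqP; rewrite -subr_eq0 opprD addrA subrr sub0r oppr_eq0 => /eqP.
apply: sqsum_eq0; apply/eqP; rewrite eq_le sqsum_ge0 andbT.
apply/lee_addgt0Pr => e e0; rewrite add0e.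
have C0 : 0 < 2 * (K + L) + 1 by lra.
have [r hr] := ket_dense f (divr_gt0 e0 C0).
set g := (f - _)%R in hr.
have -> : U f - V f = U g - V g.
  have fE : \sum_(i <- r) (f i : R[i]) *: ket i + g = f.
    by rewrite addrC subrK.
  rewrite -{1 2}fE; move: g {hr fE}; elim: r => [|i r IH] /= h.
    by rewrite big_nil add0r.
  by rewrite big_cons -addrA lU lV UV opprD addrACA subrr add0r IH.
apply: le_trans (sqsumD _ _) _.
have -> : sqsum (- V g)%R = sqsum (V g).
  apply: eq_esum => i _; congr (_ ^+ 2)%:E; exact: (normcN (V g i)).
have := UK g; have := VL g; have := sqsum_ge0 g.
rewrite -(fineK (sqsum_fin g)) -(fineK (sqsum_fin (U g))).
rewrite -(fineK (sqsum_fin (V g))) in hr *.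
move: hr; rewrite -(fineK (sqsum_fin g)) -!EFinD -!EFinM !lee_fin /=.
move: (fine _) => x; move: (fine _) => y; move: (fine _) => z.
rewrite ler_pdivlMr//; nra.
Qed.

End Density.

Local Close Scope classical_set_scope.

Record alphabet := Alphabet
  { sym :> finType; one : sym; blank : sym; _ : one != blank }.

Variant dir := Ldir | Rdir.

Definition bool_of_dir d := if d is Rdir then true else false.
Definition dir_of_bool b := if b then Rdir else Ldir.
Lemma bool_of_dirK : cancel bool_of_dir dir_of_bool. Proof. by case. Qed.
HB.instance Definition _ := Finite.copy dir (can_type bool_of_dirK).

(* inl a is the symbol a, inr a is the extra symbol \bar a *)
Notation tsym A := (sym A + sym A)%type.

Section TapeSymbols.
Context {A : alphabet}.
Implicit Types (a : tsym A) (s : seq (tsym A)).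

Definition plain a : bool := if a is inl _ then true else false.
Definition barred a : bool := ~~ plain a.
Definition base a : A := match a with inl b => b | inr b => b end.

Definition tblank : tsym A := inl (blank A).

Definition bcons a s : seq (tsym A) :=
  if (a == tblank) && nilp s then [::] else a :: s.

(* removal of the blanks at the right, resp. left, end of a word *)
Definition rstrip s : seq (tsym A) := foldr bcons [::] s.
Definition lstrip s : seq (tsym A) := rev (rstrip (rev s)).

End TapeSymbols.

(* Only the values delta0 q a p b d with q \notin Qt and p \notin Qs, that is
   with (q, a) in S_0 and (p, b) in T_0, are part of the machine. *)
Record preQTM (R : realType) (A : alphabet) := PreQTM {
  Q : finType;
  Qs : {set Q};
  Qt : {set Q};
  delta0 : Q -> A -> Q -> A -> dir -> R[i];
  qi : Q;
  qf : Q;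
  _ : [disjoint Qs & Qt];
  _ : qi \in Qs;
  _ : qf \in Qt
}.

Section PreQTM.
Context {R : realType} {A : alphabet}.
Variable M : preQTM R A.
Local Notation Q := (Q M).
Local Notation Qs := (Qs M).
Local Notation Qt := (Qt M).

Definition Q0 : {set Q} := ~: (Qs :|: Qt).

Definition U1 : Prop := forall q a, q \in Q0 :|: Qs ->
  \sum_(p in Q0 :|: Qt) \sum_(b : A) \sum_(d : dir)
    `|delta0 q a p b d| ^+ 2 = 1.

Definition U2 : Prop := forall q a q' a',
  q \in Q0 :|: Qs -> q' \in Q0 :|: Qs -> (q, a) <> (q', a') ->
  \sum_(p in Q0 :|: Qt) \sum_(b : A) \sum_(d : dir)
    (delta0 q' a' p b d)^* * delta0 q a p b d = 0.

Definition U3 : Prop := forall q a b q' a' b',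
  q \in Q0 :|: Qs -> q' \in Q0 :|: Qs ->
  \sum_(p in Q0 :|: Qt)
    (delta0 q' a' p b' Ldir)^* * delta0 q a p b Rdir = 0.

Definition is_QTM : Prop := [/\ U1, U2 & U3].

Variant mode := m0 | ms | mt.

Definition S_ (x : mode) : {set Q * tsym A} :=
  match x with
  | m0 => [set s | (s.1 \in Q0 :|: Qs) && plain s.2]
  | ms => [set s | (s.1 \in Qs) && barred s.2]
  | mt => [set s | (s.1 \in Qt) && plain s.2]
  end.

Definition T_ (x : mode) : {set Q * tsym A} :=
  match x with
  | m0 => [set t | (t.1 \in Q0 :|: Qt) && plain t.2]
  | ms => [set t | (t.1 \in Qs) && plain t.2]
  | mt => [set t | (t.1 \in Qt) && barred t.2]
  end.

Definition delta_ (x : mode) (s t : Q * tsym A) (d : dir) : R[i] :=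
  match x with
  | m0 => delta0 s.1 (base s.2) t.1 (base t.2) d
  | ms => ((t, d) == ((s.1, inl (base s.2)), Rdir))%:R
  | mt => ((t, d) == ((s.1, inr (base s.2)), Rdir))%:R
  end.

(* A class of triples modulo blank padding is represented by its unique
   member (al, q, be) where al does not start and be does not end with a
   blank. *)
Definition is_config (c : seq (tsym A) * Q * seq (tsym A)) : bool :=
  let: (al, q, be) := c in
  [&& lstrip al == al, rstrip be == be,
      (q \in Q0) ==> all plain (al ++ be),
      (q \in Qs) ==> all plain al &&
                     (be == [seq a <- be | barred a] ++ [seq a <- be | plain a])
    & (q \in Qt) ==> all plain be &&
                     (al == [seq a <- al | plain a] ++ [seq a <- al | barred a])].

Record config := Config
  { cval : seq (tsym A) * Q * seq (tsym A); _ : is_config cval }.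
HB.instance Definition _ := [isSub for cval].
HB.instance Definition _ := [Countable of config by <:].

Definition left_word (C : config) := (cval C).1.1.
Definition state (C : config) := (cval C).1.2.
Definition right_word (C : config) := (cval C).2.

Definition scanned (C : config) : tsym A := head tblank (right_word C).

Definition gamma_raw (C : config) (p : Q) (v : tsym A) (d : dir) :
    seq (tsym A) * Q * seq (tsym A) :=
  let al := left_word C in
  let be := behead (right_word C) in
  match d with
  | Rdir => (lstrip (rcons al v), p, rstrip be)
  | Ldir => (lstrip (rev (behead (rev al))), p,
             rstrip (last tblank al :: v :: be))
  end.

(* gamma_raw C t.1 t.2 d is a configuration whenever the amplitude of (t, d) is
   nonzero (gammaE), so the default value C of insubd never contributes. *)
Definition gamma (C : config) (t : Q * tsym A) (d : dir) : config :=
  insubd C (gamma_raw C t.1 t.2 d).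

Lemma head_bcons (a : tsym A) s : head tblank (bcons a s) = a.
Proof. by rewrite /bcons; case: eqP => [->|]//; case: s. Qed.

Lemma behead_bcons (a : tsym A) s : behead (bcons a s) = s.
Proof. by rewrite /bcons; case: ifP => // /andP[_ /nilP->]. Qed.

Lemma bcons_inj (a b : tsym A) s s' :
  bcons a s = bcons b s' -> a = b /\ s = s'.
Proof.
move=> e; split.
  by rewrite -(head_bcons a s) e head_bcons.
by rewrite -(behead_bcons a s) e behead_bcons.
Qed.

Lemma all_bcons (P : pred (tsym A)) a s : P a -> all P s -> all P (bcons a s).
Proof. by move=> Pa Ps; rewrite /bcons; case: ifP => //= _; rewrite Pa. Qed.

Lemma all_rstrip (P : pred (tsym A)) s : all P s -> all P (rstrip s).
Proof. by elim: s => //= a s IH /andP[Pa /IH]; exact: all_bcons. Qed.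

Lemma rstripK (s : seq (tsym A)) : rstrip (rstrip s) = rstrip s.
Proof.
elim: s => //= a s IH; rewrite {2}/bcons; case: ifP => [/andP[/eqP-> e]|e].
  by rewrite /bcons eqxx e.
by rewrite {1}/bcons e /= IH /bcons e.
Qed.

Lemma lstripK (s : seq (tsym A)) : lstrip (lstrip s) = lstrip s.
Proof. by rewrite /lstrip revK rstripK. Qed.

Lemma all_lstrip (P : pred (tsym A)) s : all P s -> all P (lstrip s).
Proof. by move=> Ps; rewrite /lstrip all_rev all_rstrip// all_rev. Qed.

Lemma rstrip_behead (s : seq (tsym A)) :
  rstrip s = s -> rstrip (behead s) = behead s.
Proof. by case: s => //= a s e; rewrite -[LHS](behead_bcons a) e. Qed.

Lemma rstrip_head_behead (s : seq (tsym A)) :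
  rstrip s = s -> s = bcons (head tblank s) (behead s).
Proof.
case: s => [|a s]; first by rewrite /= /bcons eqxx.
by move=> /= e; rewrite -{1}e; congr bcons; rewrite -[LHS](behead_bcons a) e.
Qed.

Lemma lstrip_rcons (s : seq (tsym A)) a : lstrip s = s ->
  lstrip (rcons s a) = rev (bcons a (rev s)).
Proof.
by rewrite /lstrip rev_rcons /= => e; congr (rev (bcons _ _)); rewrite -[in RHS]e revK.
Qed.

Lemma rstrip_rev (s : seq (tsym A)) : lstrip s = s -> rstrip (rev s) = rev s.
Proof. by move=> {2}<-; rewrite /lstrip revK. Qed.


Lemma configP (C : config) :
  is_config (left_word C, state C, right_word C).
Proof. by case: C => -[[al q] be]. Qed.

Lemma left_strip (C : config) : lstrip (left_word C) = left_word C.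
Proof. by have /and5P[/eqP] := configP C. Qed.

Lemma right_strip (C : config) : rstrip (right_word C) = right_word C.
Proof. by have /and5P[_ /eqP] := configP C. Qed.

Lemma filter_all_plain (s : seq (tsym A)) : all plain s ->
  [seq a <- s | barred a] = [::].
Proof.
by move=> ps; apply/eqP; rewrite -size_eq0 size_filter eqn0Ngt -has_count -all_predC;
  apply: sub_all ps => a /= pa; rewrite negbK.
Qed.

Lemma plain_config al (q : Q) be : all plain al -> all plain be ->
  is_config (lstrip al, q, rstrip be).
Proof.
move=> /all_lstrip pl /all_rstrip pr.
rewrite /is_config lstripK rstripK !eqxx all_cat pl pr /=.
rewrite !filter_all_plain// !(all_filterP _) // cats0 !eqxx.
by rewrite !implybT.
Qed.

Lemma bars_rstrip (s : seq (tsym A)) :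
  s == [seq a <- s | barred a] ++ [seq a <- s | plain a] ->
  rstrip s == [seq a <- rstrip s | barred a] ++ [seq a <- rstrip s | plain a].
Proof.
elim: s => //= -[a|a] s IH /=; last first.
  rewrite eqseq_cons eqxx /= => /IH /eqP e.
  by rewrite /bcons /= -e eqxx.
case E: [seq a <- s | barred a] => [|b t] /= h; last first.
  have : b \in [seq a <- s | barred a] by rewrite E mem_head.
  move: h; rewrite eqseq_cons => /andP[/eqP <- _].
  by rewrite mem_filter.
have ps : all plain s.
  apply/allP => x xs; apply: contraT => px.
  have : x \in [seq a <- s | barred a] by rewrite mem_filter /barred px xs.
  by rewrite E.
have pb : all plain (bcons (inl a) (rstrip s)).
  by apply: all_bcons => //; exact: all_rstrip.
by rewrite filter_all_plain// (all_filterP _)// cat0s.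
Qed.

Lemma bars_lstrip (s : seq (tsym A)) :
  s == [seq a <- s | plain a] ++ [seq a <- s | barred a] ->
  lstrip s == [seq a <- lstrip s | plain a] ++ [seq a <- lstrip s | barred a].
Proof.
move=> h; rewrite /lstrip !filter_rev -rev_cat (inj_eq (can_inj revK)).
by apply: bars_rstrip; rewrite !filter_rev -rev_cat (inj_eq (can_inj revK)).
Qed.

Lemma QsQt (q : Q) : q \in Qs -> q \in Qt -> False.
Proof.
by case: M q => Q' Qs' Qt' ? ? ? /= /disjointFr d _ _ q /d ->.
Qed.

Lemma state_scanned (C : config) x : (state C, scanned C) \in S_ x ->
  match x with
  | m0 => [/\ all plain (left_word C) & all plain (right_word C)]
  | ms => all plain (left_word C) /\
     right_word C == [seq a <- right_word C | barred a] ++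
                     [seq a <- right_word C | plain a]
  | mt => all plain (right_word C) /\
     left_word C == [seq a <- left_word C | plain a] ++
                     [seq a <- left_word C | barred a]
  end.
Proof.
have /and5P[_ _ h0 hs ht] := configP C.
case: x; rewrite inE /=.
- move=> /andP[+ sc]; rewrite finset.in_setU => /orP[q0|qs].
    by move: h0; rewrite q0 all_cat => /andP.
  move: hs; rewrite qs => /andP[-> /eqP h]; split=> //.
  move: sc h; rewrite /scanned; case: (right_word C) => //= -[a|//] s _ /=.
  case E: [seq a <- s | barred a] => [|b t] /= h.
    case: h => h; apply/allP => x xs; apply: contraT => px.
    have : x \in [seq a <- s | barred a] by rewrite mem_filter /barred px xs.
    by rewrite E.
  have : b \in [seq a <- s | barred a] by rewrite E mem_head.
  by case: h => <- _; rewrite mem_filter.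
- by move=> /andP[qs _]; move: hs; rewrite qs => /andP.
- by move=> /andP[qs _]; move: ht; rewrite qs => /andP.
Qed.

Lemma gammaE (C : config) x t d : (state C, scanned C) \in S_ x ->
  t \in T_ x -> delta_ x (state C, scanned C) t d != 0 ->
  cval (gamma C t d) = gamma_raw C t.1 t.2 d.
Proof.
move=> sC tT dn0; rewrite /gamma val_insubd.
suff -> : is_config (gamma_raw C t.1 t.2 d) by [].
have := state_scanned sC; case: x sC tT dn0 => /=; rewrite !inE.
- move=> /andP[_ _] /andP[_ tp] _ [pl pr].
  rewrite /gamma_raw; case: d.
    apply: plain_config.
      rewrite all_rev; move: pl; rewrite -all_rev.
      by case: (rev _) => //= a s /andP[].
    rewrite /= tp; move: pr; case: (right_word C) => /= [|a s]; last case/andP=> _ ->.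
      rewrite !andbT; case/lastP: (left_word C) pl => // s a.
      by rewrite all_rcons last_rcons => /andP[].
    rewrite !andbT; case/lastP: (left_word C) pl => // s' b.
    by rewrite all_rcons last_rcons => /andP[].
  apply: plain_config; first by rewrite all_rcons tp.
  by move: pr; case: (right_word C) => //= a s /andP[].
- move=> /andP[qs sb] _ + [pl pr]; rewrite pnatr_eq0 eqb0 negbK => /eqP[-> ->].
  rewrite /gamma_raw /is_config lstripK rstripK !eqxx qs /=.
  have -> : state C \in Q0 = false by rewrite !inE qs.
  have -> : state C \in Qt = false by apply/negP; exact: QsQt.
  rewrite /= andbT all_lstrip ?all_rcons//=; apply: bars_rstrip.
  move: sb pr; rewrite /scanned; case: (right_word C) => //= -[//|a] s _ /=.
  by rewrite eqseq_cons eqxx.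
- move=> /andP[qt sb] _ + [pr pl]; rewrite pnatr_eq0 eqb0 negbK => /eqP[-> ->].
  rewrite /gamma_raw /is_config lstripK rstripK !eqxx qt /=.
  have -> : state C \in Q0 = false by rewrite !inE qt orbT.
  have -> : state C \in Qs = false by apply/negP => /QsQt/(_ qt).
  rewrite /= all_rstrip/=; last by move: pr; case: (right_word C) => //= a s /andP[].
  apply: bars_lstrip; rewrite !filter_rcons /=.
  by rewrite -rcons_cat -(eqP pl).
Qed.

Lemma gamma_raw_inj (C D : config) p v d :
  state C = state D -> scanned C = scanned D ->
  gamma_raw C p v d = gamma_raw D p v d -> C = D.
Proof.
move=> eq_q eq_u e; apply/val_inj.
suff [eq_l eq_r] : left_word C = left_word D /\
                   behead (right_word C) = behead (right_word D).
  have eq_r' : right_word C = right_word D.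
    rewrite (rstrip_head_behead (right_strip C)).
    by rewrite (rstrip_head_behead (right_strip D)) -/(scanned _) eq_u eq_r.
  move: eq_q eq_l eq_r'; rewrite /state /left_word /right_word /=.
  by case: (cval C) => -[? ?] ?; case: (cval D) => -[? ?] ? /= -> -> ->.
move: e; rewrite /gamma_raw; case: d => -[].
  move=> e1 e2.
  have [e3 /bcons_inj[_]] := bcons_inj e2.
  rewrite !rstrip_behead ?right_strip// => ->; split=> //.
  have rK E : rstrip (behead (rev (left_word E))) = behead (rev (left_word E)).
    by rewrite rstrip_behead// rstrip_rev// left_strip.
  move: e1; rewrite /lstrip !revK !rK => /(can_inj revK) e4.
  apply: (can_inj revK).
  rewrite (rstrip_head_behead (rstrip_rev (left_strip C))).
  rewrite (rstrip_head_behead (rstrip_rev (left_strip D))) e4; congr bcons.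
  have hl (s : seq (tsym A)) : head tblank (rev s) = last tblank s.
    by case/lastP: s => // s a; rewrite rev_rcons last_rcons.
  by rewrite !hl.
rewrite !lstrip_rcons ?left_strip// => /(can_inj revK)/bcons_inj[_].
move=> /(can_inj revK) ->; rewrite !rstrip_behead ?right_strip//.
Qed.

Lemma S_disjoint s x y : s \in S_ x -> s \in S_ y -> x = y.
Proof.
case: s => q u; case: x; case: y => //=; rewrite !inE /barred /=;
  case: (plain u); rewrite ?andbF //=.
- by rewrite !andbT => /orP[/norP[_ /negPf ->]//|qs /(QsQt qs)].
- by rewrite !andbT => qt /orP[/norP[_]|/QsQt/(_ qt)//]; rewrite qt.
Qed.

Lemma S_cover (C : config) : exists x, (state C, scanned C) \in S_ x.
Proof.
have /and5P[_ _ h0 hs ht] := configP C.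
have [qs|nqs] := boolP (state C \in Qs).
  case E: (plain (scanned C)).
    by exists m0; rewrite !inE /= qs E orbT.
  by exists ms; rewrite !inE /= qs /barred E.
have pl : all plain (right_word C) -> plain (scanned C).
  by rewrite /scanned; case: (right_word C) => //= a s /andP[].
have [qt|nqt] := boolP (state C \in Qt).
  by exists mt; move: ht; rewrite !inE qt /= => /andP[/pl].
have q0 : state C \in Q0 by rewrite !inE negb_or nqs.
exists m0; rewrite !inE /= negb_or nqs nqt /=; apply: pl.
by move: h0; rewrite q0 all_cat => /andP[].
Qed.

(* U is a bounded extension of W_M: linearity makes the values of W_M on the
   |C> determine U on their span. *)
Definition bounded_extension (U : l2 R config -> l2 R config) : Prop :=
  bounded_linear U /\
  forall x (C : config), (state C, scanned C) \in S_ x ->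
    U (ket C) = \sum_(t in T_ x) \sum_(d : dir)
      delta_ x (state C, scanned C) t d *: ket (gamma C t d).

Local Notation move := ((Q * tsym A) * (Q * tsym A) * dir)%type.

Definition mode_of (s : Q * tsym A) : mode :=
  if s \in S_ m0 then m0 else if s \in S_ ms then ms else mt.

Lemma mode_ofE s x : s \in S_ x -> mode_of s = x.
Proof.
move=> sx; apply: (S_disjoint _ sx); rewrite /mode_of.
case: (boolP (s \in S_ m0)) => // n0; case: (boolP (s \in S_ ms)) => // n1.
by case: x sx n0 n1 => // ->.
Qed.

Definition move_coef (k : move) : R[i] :=
  let x := mode_of k.1.1 in
  if (k.1.1 \in S_ x) && (k.1.2 \in T_ x) then delta_ x k.1.1 k.1.2 k.2 else 0.

Definition move_source (k : move) (C : config) : option config :=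
  if pselect (exists D : config,
    (state D, scanned D) = k.1.1 /\ gamma D k.1.2 k.2 = C) is left h
  then Some (projT1 (cid h)) else None.

Lemma move_sourceP k C D : move_source k C = Some D ->
  (state D, scanned D) = k.1.1 /\ gamma D k.1.2 k.2 = C.
Proof.
by rewrite /move_source; case: pselect => // h [<-]; case: (cid h).
Qed.

Lemma move_source_inj k C C' D :
  move_source k C = Some D -> move_source k C' = Some D -> C = C'.
Proof. by move=> /move_sourceP[_ <-] /move_sourceP[_ <-]. Qed.

Lemma move_source_gamma k D : move_coef k != 0 ->
  (state D, scanned D) = k.1.1 ->
  move_source k (gamma D k.1.2 k.2) = Some D.
Proof.
rewrite /move_coef; case: ifP => [/andP[sS tT] dn0 sD|_]; last by rewrite eqxx.
rewrite /move_source; case: pselect => [h|[]]; last by exists D.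
case: (cid h) => E /= [sE gE]; congr Some.
have := gammaE (C := E) (x := mode_of k.1.1) (t := k.1.2) (d := k.2).
rewrite sE => /(_ sS tT dn0) vE.
have := gammaE (C := D) (x := mode_of k.1.1) (t := k.1.2) (d := k.2).
rewrite sD => /(_ sS tT dn0) vD.
move: vE; rewrite gE vD => e.
move: sE; rewrite -sD => -[e1 e2].
exact: gamma_raw_inj e1 e2 (esym e).
Qed.

Lemma shift_ket k C : move_coef k != 0 ->
  shift (@move_source_inj k) (ket C) =
  if (state C, scanned C) == k.1.1 then ket (gamma C k.1.2 k.2) else 0
    :> l2 R config.
Proof.
move=> ck; apply/val_inj/funext => D /=; rewrite /shift_fun.
case: eqP => [sC|nC] /=; last first.
  case E: (move_source k D) => [D'|//].
  rewrite /ket_fun; case: eqP => // e; case: nC.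
  by move/move_sourceP : E => [<- _]; rewrite e.
rewrite /ket_fun; case: (eqVneq D (gamma C k.1.2 k.2)) => [->|ne].
  by rewrite move_source_gamma// eqxx.
case E: (move_source k D) => [D'|//].
case: eqP => // e; move/move_sourceP : E => [_ gD].
by move: ne; rewrite -gD e eqxx.
Qed.

Definition move_sum (f : l2 R config) : l2 R config :=
  \sum_(k : move) move_coef k *: shift (@move_source_inj k) f.

Lemma move_sumP : bounded_extension move_sum.
Proof.
split.
  split; first by apply: linear_sum => k; exact: shift_linear.
  apply/sq_bounded_bounded/sq_bounded_sum => k; exact: shift_sq_bounded.
move=> x C sC; rewrite /move_sum; set s := (state C, scanned C) in sC *.
transitivity (\sum_(k : move) if k.1.1 == s then
    move_coef k *: (ket (gamma C k.1.2 k.2) : l2 R config) else 0).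
  apply: eq_bigr => k _; have [->|ck] := eqVneq (move_coef k) 0.
    by rewrite !scale0r; case: ifP.
  rewrite shift_ket// -/s eq_sym; case: ifP => // _; exact: scaler0.
rewrite -(pair_bigA _ (fun st d => if st.1 == s then move_coef (st, d) *:
   (ket (gamma C st.2 d) : l2 R config) else 0)) /=.
rewrite -(pair_bigA _ (fun s' t => \sum_d if s' == s then
   move_coef ((s', t), d) *: (ket (gamma C t d) : l2 R config) else 0)) /=.
rewrite (bigD1 s) //= [X in _ + X]big1 ?addr0; last first.
  by move=> s' /negPf ns; apply: big1 => t _; apply: big1 => d _; rewrite ns.
rewrite eqxx [RHS]big_mkcond /=; apply: eq_bigr => t _.
rewrite /move_coef /= (mode_ofE sC) sC /=.
by case: ifP => // _; apply: big1 => d _; rewrite scale0r.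
Qed.

Lemma bounded_extension_exists :
  exists U : l2 R config -> l2 R config, bounded_extension U.
Proof. by exists move_sum; exact: move_sumP. Qed.

Lemma bounded_extension_unique (U V : l2 R config -> l2 R config) :
  bounded_extension U -> bounded_extension V -> U = V.
Proof.
move=> [bU hU] [bV hV]; apply: bounded_linear_unique => // C.
by have [x sC] := S_cover C; rewrite (hU _ _ sC) (hV _ _ sC).
Qed.

(* The choice is immaterial by bounded_extension_unique. *)
Definition time_evolution : l2 R config -> l2 R config :=
  projT1 (cid bounded_extension_exists).

Lemma time_evolutionP : bounded_extension time_evolution.
Proof. exact: projT2 (cid bounded_extension_exists). Qed.

End PreQTM.

Arguments time_evolution {R A} M _.

(* Main.v *)
Require Import Defs.
From HB Require Import structures.
From mathcomp Require Import all_boot all_order all_algebra.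
From mathcomp Require Import complex boolp classical_sets functions.
From mathcomp Require Import reals ereal numfun esum.
From mathcomp Require Import ring lra.

Set Implicit Arguments.
Unset Strict Implicit.
Unset Printing Implicit Defensive.

Import Order.TTheory GRing.Theory Num.Theory.
Import ComplexField.Normc.

(** The adjoint of the time evolution is an explicit finite sum of partial
    shifts, so unitarity amounts to two facts about kets: their images are
    orthonormal, and every ket is an image.

    Configurations scanning barred symbols, and those in final states, are
    permuted by the evolution, onto configurations that no other move reaches.
    On the remaining, plain configurations the inner product of two images is
    the sum in (U1) or (U2) plus sums as in (U3), which gives the equivalence
    between orthonormality and (U1)-(U3).

    Surjectivity onto plain kets is a counting argument. For a target state p
    and symbols b, b', let w(p, b, b') be the total squared amplitude of the
    moves writing b and going right into p, plus those writing b' and going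
    left into p. Under (U1)-(U3), 1 - w(p, b, b') is a sum of squares, hence
    nonnegative; summing over p, b, b' with (U1) and |Qt| <= |Qs| gives at most
    0. So all those squares vanish, and their vanishing says that an explicit
    combination of predecessors evolves to the given ket. *)

(** * Linearity of real and complex sums of absolutely summable families *)

Section Summation.
Local Open Scope classical_set_scope.
Local Open Scope ring_scope.
Local Open Scope complex_scope.
Context {R : realType} {I : choiceType}.
Implicit Types (a b u v : I -> R) (z w : I -> R[i]).

Definition asummable a : Prop :=
  (\esum_(i in [set: I]) `|a i|%:E < +oo)%E.

Definition nnsum u : R := fine (\esum_(i in [set: I]) (u i)%:E).

Lemma asummable_le a b : (forall i, `|a i| <= `|b i|) ->
  asummable b -> asummable a.
Proof.
by move=> ab; apply: le_lt_trans; apply: le_esum => i _; rewrite lee_fin.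
Qed.

Lemma asummableD a b : asummable a -> asummable b ->
  asummable (fun i => a i + b i).
Proof.
move=> sa sb; rewrite /asummable.
apply: (@le_lt_trans _ _ (\esum_(i in [set: I]) (`|a i|%:E + `|b i|%:E))%E).
  by apply: le_esum => i _; rewrite -EFinD lee_fin ler_normD.
by rewrite esumD ?lte_add_pinfty// => i _; rewrite lee_fin.
Qed.

Lemma asummableZ (k : R) a : asummable a -> asummable (fun i => k * a i).
Proof.
move=> sa; apply: (@le_lt_trans _ _ (`|k|%:E * \esum_(i in [set: I]) `|a i|%:E)%E).
  rewrite (@eq_esum _ _ _ _ (fun i => (`|k| * `|a i|)%:E)).
    by apply: esumZl => // i.
  by move=> i _; rewrite normrM.
by rewrite lte_mul_pinfty// lee_fin.
Qed.

Lemma asummableN a : asummable a -> asummable (fun i => - a i).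
Proof. by apply: asummable_le => i; rewrite normrN. Qed.

Lemma asummable_max0 a : asummable a -> asummable (fun i => Num.max (a i) 0).
Proof.
apply: asummable_le => i; rewrite [X in X <= _]ger0_norm ?le_max ?lexx ?orbT//.
by rewrite ge_max normr_ge0 ler_norm.
Qed.

Lemma nnsum_fin u : (forall i, 0 <= u i) -> asummable u ->
  (\esum_(i in [set: I]) (u i)%:E)%E \is a fin_num.
Proof.
move=> u0 su; rewrite ge0_fin_numE; last by apply: esum_ge0 => i _; rewrite lee_fin.
apply: le_lt_trans su; apply: le_esum => i _; by rewrite lee_fin ler_norm.
Qed.

Lemma nnsumD u v : (forall i, 0 <= u i) -> (forall i, 0 <= v i) ->
  asummable u -> asummable v ->
  nnsum (fun i => u i + v i) = nnsum u + nnsum v.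
Proof.
move=> u0 v0 su sv; rewrite /nnsum -fineD ?nnsum_fin//; congr fine.
by rewrite -esumD// => i _; rewrite lee_fin.
Qed.

(** Any splitting into nonnegative summable families computes [rsum], not only the one into positive
    and negative parts. Additivity follows by adding the two splittings termwise. *)
Lemma rsumB u v : (forall i, 0 <= u i) -> (forall i, 0 <= v i) ->
  asummable u -> asummable v ->
  rsum (fun i => u i - v i) = nnsum u - nnsum v.
Proof.
move=> u0 v0 su sv; rewrite /rsum /nnsum.
have suv : asummable (fun i => u i - v i).
  by apply: asummableD => //; exact: asummableN.
have E : EFin \o (fun i => u i - v i) = ((EFin \o u) \- (EFin \o v))%E.
  by apply/funext => i /=; rewrite EFinB.
rewrite -!fineB ?nnsum_fin//.
- rewrite E; congr fine; apply: esumB => //.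
  + by move=> i _; rewrite /= lee_fin.
  + by move=> i _; rewrite /= lee_fin.
- have := @summable_funepos _ _ setT (EFin \o (fun i => u i - v i)) suv; rewrite summableE.
  by congr (_ \is a fin_num); apply: eq_esum => i _; rewrite gee0_abs.
- have := @summable_funeneg _ _ setT (EFin \o (fun i => u i - v i)) suv; rewrite summableE.
  by congr (_ \is a fin_num); apply: eq_esum => i _; rewrite gee0_abs.
Qed.

Lemma rsumE a : rsum a =
  nnsum (fun i => Num.max (a i) 0) - nnsum (fun i => Num.max (- a i) 0).
Proof.
rewrite /rsum /nnsum; congr (fine _ - fine _); apply: eq_esum => i _.
  by rewrite funeposE /= EFin_max.
by rewrite funenegE /= EFin_max.
Qed.

Lemma max0B (x : R) : x = Num.max x 0 - Num.max (- x) 0.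
Proof. by case: (leP x 0) => x0; case: (leP (- x) 0) => nx0; lra. Qed.

Lemma rsumD a b : asummable a -> asummable b ->
  rsum (fun i => a i + b i) = rsum a + rsum b.
Proof.
move=> sa sb; rewrite [in RHS]rsumE [X in _ + X]rsumE.
have M0 (x : R) : 0 <= Num.max x 0 by rewrite le_max lexx orbT.
have sp := asummable_max0.
rewrite addrACA -opprD -!nnsumD// ?[RHS]/=; do ?[exact: sp|exact/sp/asummableN].
rewrite -rsumB//.
- by congr rsum; apply/funext => i; rewrite [in LHS](max0B (a i)) [in LHS](max0B (b i)); ring.
- by move=> i; rewrite addr_ge0.
- by move=> i; rewrite addr_ge0.
- by apply: asummableD; exact: sp.
- by apply: asummableD; exact/sp/asummableN.
Qed.

Lemma rsumN a : rsum (fun i => - a i) = - rsum a.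
Proof.
rewrite !rsumE opprB; congr (_ - nnsum _).
by apply/funext => i; rewrite opprK.
Qed.

(** [esumZl] bounds the scaled sum by the multiple of the sum; the converse bound is the same
    inequality for the factor [k^-1] and the family [k * u i]. *)
Lemma nnsumZ (k : R) u : 0 <= k -> (forall i, 0 <= u i) -> asummable u ->
  nnsum (fun i => k * u i) = k * nnsum u.
Proof.
have half (l : R) v : 0 <= l -> (forall i, 0 <= v i) -> asummable v ->
    nnsum (fun i => l * v i) <= l * nnsum v.
  move=> l0 v0 sv; rewrite -lee_fin EFinM !fineK ?nnsum_fin//.
  - exact: esumZl.
  - by move=> i; rewrite mulr_ge0.
  - exact: asummableZ.
move=> k0 u0 su; apply/eqP; rewrite eq_le half//=.
have [->|kn0] := eqVneq k 0.
  rewrite mul0r /nnsum fine_ge0//; apply: esum_ge0 => i _.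
  by rewrite lee_fin mul0r.
have kp : 0 < k by rewrite lt_neqAle eq_sym kn0.
have := half k^-1 (fun i => k * u i); rewrite invr_ge0 k0.
have -> : (fun i => k^-1 * (k * u i)) = u by apply/funext => i; rewrite mulKf.
rewrite ler_pdivlMl//; apply=> //; last exact: asummableZ.
by move=> i; rewrite mulr_ge0.
Qed.

Lemma rsumZ (k : R) a : asummable a -> rsum (fun i => k * a i) = k * rsum a.
Proof.
have pos (l : R) : 0 <= l -> asummable a ->
    rsum (fun i => l * a i) = l * rsum a.
  move=> l0 sa; rewrite [in RHS]rsumE mulrBr -!nnsumZ//; last 4 first.
  - by move=> i; rewrite le_max lexx orbT.
  - exact/asummable_max0/asummableN.
  - by move=> i; rewrite le_max lexx orbT.
  - exact/asummable_max0.
  rewrite rsumE; congr (nnsum _ - nnsum _); apply/funext => i.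
    by rewrite -[X in Num.max _ X](mulr0 l) maxr_pMr.
  by rewrite -mulrN -[X in Num.max _ X](mulr0 l) maxr_pMr.
move=> sa; have [k0|k0] := leP 0 k; first exact: pos.
have := pos (- k); rewrite oppr_ge0 (ltW k0) => /(_ isT sa).
under eq_fun do rewrite mulNr.
by rewrite rsumN mulNr => /oppr_inj.
Qed.

Definition csummable z : Prop :=
  asummable (fun i => complex.Re (z i)) /\ asummable (fun i => complex.Im (z i)).

Lemma csumD z w : csummable z -> csummable w ->
  csum (fun i => z i + w i) = csum z + csum w.
Proof.
move=> [rz iz] [rw iw]; rewrite /csum /=.
have -> : (fun i => complex.Re (z i + w i)) =
  (fun i => complex.Re (z i) + complex.Re (w i)).
  by apply/funext => i; case: (z i) => ? ?; case: (w i).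
have -> : (fun i => complex.Im (z i + w i)) =
  (fun i => complex.Im (z i) + complex.Im (w i)).
  by apply/funext => i; case: (z i) => ? ?; case: (w i).
by rewrite !rsumD.
Qed.

Lemma csumZ (c : R[i]) z : csummable z ->
  csum (fun i => c * z i) = c * csum z.
Proof.
move=> [rz iz]; case: c => x y; rewrite /csum.
have -> : (fun i => complex.Re (Complex x y * z i)) =
  (fun i => x * complex.Re (z i) + (- y) * complex.Im (z i)).
  by apply/funext => i; case: (z i) => ? ? /=; rewrite mulNr.
have -> : (fun i => complex.Im (Complex x y * z i)) =
  (fun i => x * complex.Im (z i) + y * complex.Re (z i)).
  by apply/funext => i; case: (z i) => ? ? /=; ring.
rewrite !rsumD ?rsumZ//; do ?exact: asummableZ.
by apply/eqP; rewrite eq_complex /= mulNr !eqxx.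
Qed.

Lemma csum_conj z : csum (fun i => (z i)^*) = (csum z)^*.
Proof.
rewrite /csum /= -rsumN; apply: f_equal2; congr rsum; apply/funext => i;
  by case: (z i).
Qed.

End Summation.

(** * Sums with one nonzero term and reindexing along partial bijections *)

Section Reindex.
Local Open Scope classical_set_scope.
Local Open Scope ring_scope.
Local Open Scope complex_scope.
Context {R : realType} {I : choiceType}.

Lemma nnsum_set1 (u : I -> R) i : 0 <= u i -> (forall j, j != i -> u j = 0) ->
  nnsum u = u i.
Proof.
move=> ui0 u0; rewrite /nnsum -[RHS]/(fine (u i)%:E); congr fine.
rewrite -[RHS](@esum_set1 _ _ i (fun i => (u i)%:E)) ?lee_fin//.
rewrite [RHS]esum_mkcond; apply: eq_esum => j _.
by rewrite in_set1; case: eqVneq => [//|/u0 ->].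
Qed.

Lemma csum_set1 (z : I -> R[i]) i : (forall j, j != i -> z j = 0) ->
  csum z = z i.
Proof.
have rs (a : I -> R) : (forall j, j != i -> a j = 0) -> rsum a = a i.
  move=> a0; rewrite rsumE (nnsum_set1 (i := i)) ?(nnsum_set1 (i := i)).
  - exact/esym/max0B.
  - by rewrite le_max lexx orbT.
  - by move=> j /a0 ->; rewrite oppr0 maxxx.
  - by rewrite le_max lexx orbT.
  - by move=> j /a0 ->; rewrite maxxx.
move=> z0; rewrite /csum !rs; first by case: (z i).
- by move=> j /z0 ->.
- by move=> j /z0 ->.
Qed.

(** The hypothesis makes [s] and [t] mutually inverse partial injections, so both sides run over the
    graph of [s]. Nonnegative families come first; the general case follows by splitting into
    positive and negative, real and imaginary parts. *)
Lemma csum_partial_bij (s t : I -> option I) (z : I -> I -> R[i]) :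
  (forall i j, s i = Some j <-> t j = Some i) ->
  csum (fun i => if s i is Some j then z i j else 0) =
  csum (fun j => if t j is Some i then z i j else 0).
Proof.
move=> st.
have nn (u : I -> I -> R) : (forall i j, 0 <= u i j) ->
    nnsum (fun i => if s i is Some j then u i j else 0) =
    nnsum (fun j => if t j is Some i then u i j else 0).
  move=> u0; rewrite /nnsum; congr fine.
  pose D : set I := [set i | s i != None].
  (* The default [i] is reached only outside [D], where [e] is never summed over. *)
  pose e i := odflt i (s i).
  transitivity (\esum_(i in D) (u i (e i))%:E)%E.
    rewrite [RHS]esum_mkcond; apply: eq_esum => i _.
    rewrite /e; have [/set_mem|/negP] := boolP (i \in D).
      by rewrite /D /=; case: (s i).
    move=> nD; have : ~ D i by move=> /mem_set.
    by rewrite /D /=; case: (s i) => [j []|].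
  pose v j : \bar R := (if t j is Some i then u i j else 0)%:E.
  transitivity (\esum_(i in D) v (e i)).
    apply: eq_esum => i; rewrite /D /e /v /=.
    by case E: (s i) => [j|//] _ /=; move/st: E => ->.
  rewrite -(esum_image D e v).
    rewrite esum_mkcond; apply: eq_esum => j _.
    case: ifPn => // /negP nD; rewrite /v; case E: (t j) => [i|//].
    case: nD; apply/mem_set; exists i; rewrite /D /e /=;
      by move/st: E => ->.
  move=> i j /set_mem Di /set_mem Dj; rewrite /e; move: Di Dj; rewrite /D /=.
  case Ei: (s i) => [a|//] _; case Ej: (s j) => [b|//] _ /= ab.
  by move: Ei Ej; rewrite ab => /st + /st => -> [].
have rr (a : I -> I -> R) :
    rsum (fun i => if s i is Some j then a i j else 0) =
    rsum (fun j => if t j is Some i then a i j else 0).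
  rewrite !rsumE; congr (_ - _).
    have := nn (fun i j => Num.max (a i j) 0) (fun i j => ltac:(by rewrite le_max lexx orbT)).
    by congr (_ = _); congr nnsum; apply/funext => i;
      [case: (s i)|case: (t i)] => //; rewrite maxxx.
  have := nn (fun i j => Num.max (- a i j) 0) (fun i j => ltac:(by rewrite le_max lexx orbT)).
  by congr (_ = _); congr nnsum; apply/funext => i;
    [case: (s i)|case: (t i)] => //; rewrite oppr0 maxxx.
rewrite /csum; apply: f_equal2.
  have := rr (fun i j => complex.Re (z i j)).
  by congr (_ = _); congr rsum; apply/funext => i; [case: (s i)|case: (t i)].
have := rr (fun i j => complex.Im (z i j)).
by congr (_ = _); congr rsum; apply/funext => i; [case: (s i)|case: (t i)].
Qed.

End Reindex.

(** * Sesquilinearity of the inner product and adjoints of partial shifts *)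

Section InnerProduct.
Local Open Scope classical_set_scope.
Local Open Scope ring_scope.
Local Open Scope complex_scope.
Context {R : realType} {I : choiceType}.
Implicit Types (f g h : l2 R I) (c : R[i]).

Lemma sqsum_asummable f : asummable (fun i => normc (f i) ^+ 2).
Proof.
have := sqsum_fin f; rewrite ge0_fin_numE ?sqsum_ge0//; apply: le_lt_trans.
by apply: le_esum => i _; rewrite lee_fin ger0_norm ?sqr_ge0.
Qed.

Lemma normc_Re (x : R[i]) : `|complex.Re x| <= normc x.
Proof.
case: x => x y /=; rewrite -sqrtr_sqr ler_wsqrtr// lerDl sqr_ge0 //.
Qed.

Lemma normc_Im (x : R[i]) : `|complex.Im x| <= normc x.
Proof.
case: x => x y /=; rewrite -sqrtr_sqr ler_wsqrtr// lerDr sqr_ge0 //.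
Qed.

Lemma normc_conj (x : R[i]) : normc (x^*) = normc x.
Proof. by case: x => x y /=; rewrite sqrrN. Qed.

(** Each term has modulus at most [|f i|^2 + |g i|^2]. This is the summability on which
    sesquilinearity of [inner] rests. *)
Lemma inner_summable f g : csummable (fun i => (f i)^* * g i).
Proof.
have le i : normc ((f i)^* * g i) <= normc (f i) ^+ 2 + normc (g i) ^+ 2.
  rewrite normcM normc_conj.
  have := normc_ge0 (f i); have := normc_ge0 (g i).
  by have := sqr_ge0 (normc (f i) - normc (g i)); nra.
have sm := asummableD (sqsum_asummable f) (sqsum_asummable g).
split; apply: asummable_le sm => i; apply: le_trans (ler_norm _).
  by apply: le_trans (normc_Re _) (le i).
by apply: le_trans (normc_Im _) (le i).
Qed.

Lemma innerDr f g h : inner f (g + h) = inner f g + inner f h.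
Proof.
rewrite /inner -csumD; try exact: inner_summable.
by congr csum; apply/funext => i; rewrite -mulrDr.
Qed.

Lemma innerZr c f g : inner f (c *: g) = c * inner f g.
Proof.
rewrite /inner -csumZ; last exact: inner_summable.
by congr csum; apply/funext => i; rewrite l2ZE mulrCA.
Qed.

Lemma inner_conj f g : inner g f = (inner f g)^*.
Proof.
rewrite /inner -csum_conj; congr csum; apply/funext => i.
by rewrite rmorphM /= conjcK mulrC.
Qed.

Lemma inner0r f : inner f 0 = 0.
Proof. by rewrite -(scale0r (0 : l2 R I)) innerZr mul0r. Qed.

Lemma inner_sumr (T : Type) (r : seq T) (P : pred T) f (F : T -> l2 R I) :
  inner f (\sum_(k <- r | P k) F k) = \sum_(k <- r | P k) inner f (F k).
Proof.
by apply: (big_morph (inner f)); [exact: innerDr|exact: inner0r].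
Qed.

Lemma innerZl c f g : inner (c *: f) g = c^* * inner f g.
Proof. by rewrite (inner_conj g) innerZr rmorphM (inner_conj g f). Qed.

Lemma inner_suml (T : Type) (r : seq T) (P : pred T) (F : T -> l2 R I) g :
  inner (\sum_(k <- r | P k) F k) g = \sum_(k <- r | P k) inner (F k) g.
Proof.
rewrite inner_conj inner_sumr rmorph_sum.
by apply: eq_bigr => k _; rewrite (inner_conj g).
Qed.

Lemma inner_ketl i g : inner (ket i) g = g i.
Proof.
rewrite /inner (@csum_set1 _ _ _ i) /= /ket_fun.
  by rewrite eqxx rmorph1 mul1r.
by move=> j /negPf ->; rewrite rmorph0 mul0r.
Qed.

(** Both sides sum over the pairs with [s i = Some j], so reindexing suffices. Adjoints of finite
    combinations of partial shifts thus become explicit. *)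
Lemma inner_shift (s t : I -> option I)
    (s_inj : forall i j k, s i = Some k -> s j = Some k -> i = j)
    (t_inj : forall i j k, t i = Some k -> t j = Some k -> i = j) f g :
  (forall i j, s i = Some j <-> t j = Some i) ->
  inner (shift s_inj f) g = inner f (shift t_inj g).
Proof.
move=> st; rewrite /inner.
have := csum_partial_bij (fun i j => (f j)^* * g i) st.
congr (_ = _); congr csum; apply/funext => i; rewrite /= /shift_fun.
  by case: (s i) => // ; rewrite rmorph0 mul0r.
by case: (t i) => // ; rewrite mulr0.
Qed.

End InnerProduct.

(** * Completeness of the local amplitudes by counting *)

Section LocalCompleteness.
Local Open Scope ring_scope.
Context {C : numClosedFieldType} {T P B : finType}.
(** In the application [X] holds the pairs of a source state and a plain symbol, [Y] the target
    states, and [dR], [dL] are the amplitudes of right and left moves. Then [orth] is (U1) with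
    (U2), and [cross] is (U3). *)
Variables (X : {set T}) (Y : {set P}) (dR dL : T -> P -> B -> C).
Hypothesis orth : forall s s', s \in X -> s' \in X ->
  \sum_(p in Y) \sum_b ((dR s' p b)^* * dR s p b + (dL s' p b)^* * dL s p b) =
  (s == s')%:R.
Hypothesis cross : forall s s' b b', s \in X -> s' \in X ->
  \sum_(p in Y) (dL s' p b')^* * dR s p b = 0.
Hypothesis cardYX : (#|Y| * #|B| <= #|X|)%N.

(** With [FL]: the right-moving and left-moving amplitudes after one step from a superposition with
    coefficients [c]. *)
Let FR (c : T -> C) p b := \sum_(s in X) c s * dR s p b.
Let FL (c : T -> C) p b := \sum_(s in X) c s * dL s p b.

Let conj_sum_mul (c c' e e' : T -> C) :
  (\sum_(s in X) c s * e s)^* * (\sum_(s in X) c' s * e' s) =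
  \sum_(s' in X) \sum_(s in X) ((c s')^* * c' s) * ((e s')^* * e' s).
Proof.
rewrite rmorph_sum big_distrlr /=; apply: eq_bigr => s' _.
by apply: eq_bigr => s _; rewrite rmorphM /=; ring.
Qed.

Let sqr_norm_addB (x y : C) (e : bool) :
  `|x + y - e%:R| ^+ 2 = `|x| ^+ 2 + `|y| ^+ 2 + y^* * x + (y^* * x)^* +
    e%:R * (1 - (x + x^* + y + y^*)).
Proof.
rewrite !normCKC rmorphB rmorphD rmorphM /= conjCK conjC_nat.
case: e => /=; first by ring.
by ring.
Qed.

(** Expanding the squares and exchanging sums leaves the Gram matrix of [orth], so only the diagonal
    terms survive. *)
Let parseval c : \sum_(p in Y) \sum_b (`|FR c p b| ^+ 2 + `|FL c p b| ^+ 2) =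
  \sum_(s in X) `|c s| ^+ 2.
Proof.
transitivity (\sum_(s' in X) \sum_(s in X) ((c s')^* * c s) *
  (\sum_(p in Y) \sum_b ((dR s' p b)^* * dR s p b + (dL s' p b)^* * dL s p b))).
  transitivity (\sum_(p in Y) \sum_b \sum_(s' in X) \sum_(s in X)
     ((c s')^* * c s) * ((dR s' p b)^* * dR s p b + (dL s' p b)^* * dL s p b)).
    apply: eq_bigr => p _; apply: eq_bigr => b _.
    rewrite !normCKC !conj_sum_mul -big_split; apply: eq_bigr => s' _ /=.
    by rewrite -big_split; apply: eq_bigr => s _ /=; ring.
  under eq_bigr => p _ do rewrite exchange_big /=.
  rewrite exchange_big /=; apply: eq_bigr => s' _.
  under eq_bigr => p _ do rewrite exchange_big /=.
  rewrite exchange_big /=; apply: eq_bigr => s _.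
  by rewrite mulr_sumr; apply: eq_bigr => p _; rewrite mulr_sumr.
apply: eq_bigr => s' s'X; rewrite (bigD1 s') //= orth // eqxx mulr1 normCKC.
rewrite big1 ?addr0 // => s /andP[sX /negPf ne].
by rewrite orth // ne mulr0.
Qed.

Let cross_sum c c' b b' : \sum_(p in Y) (FL c' p b')^* * FR c p b = 0.
Proof.
under eq_bigr => p _ do rewrite conj_sum_mul.
rewrite exchange_big /=; apply: big1 => s' s'X.
rewrite exchange_big /=; apply: big1 => s sX.
by rewrite -mulr_sumr cross // mulr0.
Qed.

(** Squared column norms of the amplitude matrix; [rho p b + lam p b'] is the weight
    [w(p, b, b')]. *)
Let rho p b := \sum_(s in X) `|dR s p b| ^+ 2.
Let lam p b := \sum_(s in X) `|dL s p b| ^+ 2.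

Section Column.
Variables (p : P) (b b' : B).
Hypothesis pY : p \in Y.
Let r s := (dR s p b)^*.
Let l s := (dL s p b')^*.

(** The coefficients [r] and [l] are meant for the predecessors reaching the target by a right,
    resp. left, move. The first sum measures how far the amplitudes arriving on the target tape are
    from the indicator of [p]; the second collects all stray amplitudes. *)
Let defect : C :=
  \sum_(p1 in Y) `|FR r p1 b + FL l p1 b' - (p1 == p)%:R| ^+ 2 +
  \sum_(p1 in Y) (\sum_(b1 | b1 != b) `|FR r p1 b1| ^+ 2 +
    \sum_b1 `|FL r p1 b1| ^+ 2 + \sum_b1 `|FR l p1 b1| ^+ 2 +
    \sum_(b1 | b1 != b') `|FL l p1 b1| ^+ 2).

(** By [parseval] the quadratic terms give [rho + lam], the mixed terms vanish by [cross_sum], and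
    the linear terms at [p] give [1 - 2 (rho + lam)], because [FR r p b] and [FL l p b'] are the
    real numbers [rho p b] and [lam p b']. *)
Let defectE : defect = 1 - (rho p b + lam p b').
Proof.
have rhoE : FR r p b = rho p b.
  by apply: eq_bigr => s _; rewrite normCKC.
have lamE : FL l p b' = lam p b'.
  by apply: eq_bigr => s _; rewrite normCKC.
have rho0 : (rho p b)^* = rho p b.
  by apply: CrealP; rewrite ger0_real// sumr_ge0// => s _; rewrite exprn_ge0.
have lam0 : (lam p b')^* = lam p b'.
  by apply: CrealP; rewrite ger0_real// sumr_ge0// => s _; rewrite exprn_ge0.
have pr : \sum_(p1 in Y) \sum_b1 (`|FR r p1 b1| ^+ 2 + `|FL r p1 b1| ^+ 2) =
    rho p b.
  by rewrite parseval; apply: eq_bigr => s _; rewrite norm_conjC.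
have pl : \sum_(p1 in Y) \sum_b1 (`|FR l p1 b1| ^+ 2 + `|FL l p1 b1| ^+ 2) =
    lam p b'.
  by rewrite parseval; apply: eq_bigr => s _; rewrite norm_conjC.
pose e p1 : C := (p1 == p)%:R.
transitivity (\sum_(p1 in Y) (
   \sum_b1 (`|FR r p1 b1| ^+ 2 + `|FL r p1 b1| ^+ 2) +
   \sum_b1 (`|FR l p1 b1| ^+ 2 + `|FL l p1 b1| ^+ 2) +
   (FL l p1 b')^* * FR r p1 b + ((FL l p1 b')^* * FR r p1 b)^* +
   e p1 * (1 - (FR r p1 b + (FR r p1 b)^* + FL l p1 b' + (FL l p1 b')^*)))).
  rewrite /defect -big_split /=; apply: eq_bigr => p1 _.
  rewrite !big_split /= [\sum_b1 `|FR r p1 b1| ^+ 2](bigD1 b) //=.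
  rewrite [\sum_b1 `|FL l p1 b1| ^+ 2](bigD1 b') //=.
  by rewrite sqr_norm_addB; ring.
rewrite 4!big_split /=.
rewrite pr pl cross_sum -rmorph_sum cross_sum rmorph0.
rewrite (bigD1 p) //= big1 => [|p1 /andP[_ /negPf ne]]; last by rewrite /e ne mul0r.
rewrite /e eqxx rhoE lamE rho0 lam0 mul1r.
by ring.
Qed.

Lemma column_defect_ge0 : 0 <= 1 - (rho p b + lam p b').
Proof.
rewrite -defectE; apply: addr_ge0; apply: sumr_ge0 => p1 _.
  by rewrite exprn_ge0.
by do ?apply: addr_ge0; apply: sumr_ge0 => b1 _; rewrite exprn_ge0.
Qed.

Lemma column_identities : 1 - (rho p b + lam p b') = 0 ->
  [/\ forall p1, p1 \in Y -> FR r p1 b + FL l p1 b' = (p1 == p)%:R,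
      forall p1 b1, p1 \in Y -> b1 != b -> FR r p1 b1 = 0,
      forall p1 b1, p1 \in Y -> FL r p1 b1 = 0,
      forall p1 b1, p1 \in Y -> FR l p1 b1 = 0 &
      forall p1 b1, p1 \in Y -> b1 != b' -> FL l p1 b1 = 0].
Proof.
have sq (x : C) : 0 <= `|x| ^+ 2 by rewrite exprn_ge0.
have sq0 (x : C) : `|x| ^+ 2 = 0 -> x = 0.
  by move/eqP; rewrite expf_eq0 /= normr_eq0 => /eqP.
have ssq (Pb : pred B) (F : B -> C) : 0 <= \sum_(b1 | Pb b1) `|F b1| ^+ 2.
  by apply: sumr_ge0.
have ssq0 (Pb : pred B) (F : B -> C) : \sum_(b1 | Pb b1) `|F b1| ^+ 2 = 0 ->
    forall b1, Pb b1 -> F b1 = 0.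
  by move=> /psumr_eq0P F0 b1 Pb1; apply: sq0; exact: F0.
rewrite -defectE => /eqP; rewrite paddr_eq0; last 2 first.
- by apply: sumr_ge0.
- by apply: sumr_ge0 => p1 _; rewrite !addr_ge0.
move=> /andP[/eqP/psumr_eq0P h1 /eqP/psumr_eq0P h2].
have h3 p1 : p1 \in Y -> [/\ \sum_(b1 | b1 != b) `|FR r p1 b1| ^+ 2 = 0,
   \sum_b1 `|FL r p1 b1| ^+ 2 = 0, \sum_b1 `|FR l p1 b1| ^+ 2 = 0 &
   \sum_(b1 | b1 != b') `|FL l p1 b1| ^+ 2 = 0].
  move=> /h2 -/(_ (fun p1 _ => ltac:(by rewrite !addr_ge0))) /eqP.
  rewrite paddr_eq0 ?addr_ge0// => /andP[+ /eqP ->].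
  rewrite paddr_eq0 ?addr_ge0// => /andP[+ /eqP ->].
  by rewrite paddr_eq0// => /andP[/eqP -> /eqP ->].
split=> [p1 Yp1|p1 b1 Yp1|p1 b1 Yp1|p1 b1 Yp1|p1 b1 Yp1].
- by apply/eqP; rewrite -subr_eq0; apply/eqP/sq0/h1.
- by have [/ssq0 h _ _ _] := h3 _ Yp1; exact: h.
- by have [_ /ssq0 h _ _] := h3 _ Yp1; exact: h.
- by have [_ _ /ssq0 h _] := h3 _ Yp1; exact: h.
- by have [_ _ _ /ssq0 h] := h3 _ Yp1; exact: h.
Qed.

End Column.

Let total_weight : \sum_(p in Y) \sum_b (rho p b + lam p b) = #|X|%:R.
Proof.
transitivity (\sum_(s in X) \sum_(p in Y) \sum_b
   ((dR s p b)^* * dR s p b + (dL s p b)^* * dL s p b)).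
  rewrite [RHS]exchange_big /=; apply: eq_bigr => p _.
  rewrite [RHS]exchange_big /=; apply: eq_bigr => b _.
  by rewrite -big_split /=; apply: eq_bigr => s _; rewrite !normCKC.
under eq_bigr => s sX do rewrite orth // eqxx.
by rewrite sumr_const.
Qed.

(** The defects are nonnegative, and their total [|Y| |B|^2 - |B| |X|] is at most 0 by [cardYX].
    Hence each defect is 0, and so is each square in it. *)
Lemma column_completeness p b b' : p \in Y ->
  [/\ forall p1, p1 \in Y -> \sum_(s in X) (dR s p b)^* * dR s p1 b +
        \sum_(s in X) (dL s p b')^* * dL s p1 b' = (p1 == p)%:R,
      forall p1 b1, p1 \in Y -> b1 != b ->
        \sum_(s in X) (dR s p b)^* * dR s p1 b1 = 0,
      forall p1 b1, p1 \in Y -> \sum_(s in X) (dR s p b)^* * dL s p1 b1 = 0,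
      forall p1 b1, p1 \in Y -> \sum_(s in X) (dL s p b')^* * dR s p1 b1 = 0 &
      forall p1 b1, p1 \in Y -> b1 != b' ->
        \sum_(s in X) (dL s p b')^* * dL s p1 b1 = 0].
Proof.
move=> pY; apply: column_identities => //.
have ge0 p1 c c' : p1 \in Y -> 0 <= 1 - (rho p1 c + lam p1 c').
  exact: column_defect_ge0.
have : \sum_(p1 in Y) \sum_c \sum_c' (1 - (rho p1 c + lam p1 c')) <= 0.
  (* Each [rho p1 c] is counted once for every [c'] and each [lam p1 c'] once for every [c], whence
     the factor [#|B|] before the total weight. *)
  have -> : \sum_(p1 in Y) \sum_c \sum_c' (1 - (rho p1 c + lam p1 c')) =
     \sum_(p1 in Y) (#|B| * #|B|)%:R -
     #|B|%:R * \sum_(p1 in Y) \sum_c (rho p1 c + lam p1 c).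
    rewrite mulr_sumr -sumrB; apply: eq_bigr => p1 _.
    under eq_bigr => c _ do rewrite sumrB sumr_const big_split sumr_const /=.
    rewrite sumrB sumr_const big_split sumr_const /= big_split /=.
    have cB : #|(xpredT : pred B)| = #|B| by [].
    by rewrite natrM mulrDr !mulr_natl !cB -!sumrMnl.
  rewrite total_weight sumr_const -mulrnA -natrM subr_le0 ler_nat.
  by rewrite -mulnA leq_mul2l mulnC cardYX orbT.
have ge1 p1 : p1 \in Y -> 0 <= \sum_c \sum_c' (1 - (rho p1 c + lam p1 c')).
  by move=> Yp1; apply: sumr_ge0 => c _; apply: sumr_ge0 => c' _; exact: ge0.
move=> le0; have /psumr_eq0P : \sum_(p1 in Y) \sum_c \sum_c' (1 - (rho p1 c + lam p1 c')) = 0.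
  by apply/eqP; rewrite eq_le le0 sumr_ge0.
move=> /(_ ge1 p pY) /psumr_eq0P.
move=> /(_ (fun c _ => sumr_ge0 _ (fun c' _ => ge0 _ _ _ pY)) b isT) /psumr_eq0P.
by move=> /(_ (fun c' _ => ge0 _ _ _ pY) b' isT).
Qed.

End LocalCompleteness.

(** * Unitarity tested on kets *)

Section Unitarity.
Local Open Scope ring_scope.
Local Open Scope complex_scope.
Context {R : realType} {I : choiceType}.
Implicit Types (f g : l2 R I) (U V : l2 R I -> l2 R I).

Lemma innerDl f g h : inner (f + g) h = inner f h + inner g h :> R[i].
Proof. by rewrite (inner_conj h) innerDr rmorphD (inner_conj h f) (inner_conj h g). Qed.

Lemma inner_ket (i j : I) : inner (ket i) (ket j) = (i == j)%:R :> R[i].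
Proof. by rewrite inner_ketl. Qed.

Lemma inner_disjoint f g : (forall i, f i = 0 \/ g i = 0) -> inner f g = 0.
Proof.
move=> fg; have z i : (f i)^* * g i = 0.
  by case: (fg i) => ->; rewrite ?rmorph0 ?mul0r ?mulr0.
(* [csum_set1] requires an index, so an empty [I] is handled separately by pulling out a factor
   0. *)
rewrite /inner; have [i|no] := pselect (exists i : I, True).
  by case: i => i _; rewrite (@csum_set1 _ _ _ i).
have -> : (fun i => (f i)^* * g i) = (fun i => 0 * ((f i)^* * g i)).
  by apply/funext => i; rewrite z mulr0.
by rewrite csumZ ?mul0r//; exact: inner_summable.
Qed.

Lemma linear_sumZ U (T : Type) (r : seq T) (P : pred T) (c : T -> R[i])
    (F : T -> l2 R I) : linear U ->
  U (\sum_(k <- r | P k) c k *: F k) = \sum_(k <- r | P k) c k *: U (F k).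
Proof.
move=> lU; have U0 : U 0 = 0.
  have := lU (-1) 0 0; rewrite scaler0 addr0 => h.
  by rewrite h scaleN1r addNr.
elim: r => [|k r IH]; first by rewrite !big_nil.
by rewrite !big_cons; case: ifP => // _; rewrite lU IH.
Qed.

Lemma bounded_linear_comp U V : bounded_linear U -> bounded_linear V ->
  bounded_linear (U \o V).
Proof.
move=> [lU [K UK]] [lV /bounded_sq_bounded/sq_bounded_bounded [L VL]].
split=> [a f g /=|]; first by rewrite lV lU.
(* [K] may be negative, and only a nonnegative factor can be multiplied into the bound for [V]. *)
exists (`|K| * L) => f /=; apply: le_trans (UK _) _.
rewrite -mulrA; apply: le_trans (ler_wpM2r (sqrtr_ge0 _) (ler_norm K)) _.
by apply: ler_wpM2l; [exact: normr_ge0|exact: VL].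
Qed.

Lemma bounded_linear_id : bounded_linear (@id (l2 R I)).
Proof. by split=> [a f g //|]; exists 1 => f; rewrite mul1r. Qed.

(** The inner products of images of kets are the matrix entries of [V \o U], so orthonormality gives
    [V \o U = id] on kets, and everywhere by density. Surjectivity onto kets then yields
    [U \o V = id] in the same way. *)
Lemma unitary_ketP U V : bounded_linear U -> bounded_linear V -> adjoint U V ->
  unitary U <->
  (forall i j, inner (U (ket i)) (U (ket j)) = (i == j)%:R) /\
  (forall j, exists f, U f = ket j).
Proof.
move=> bU bV UV; split=> [[_ [W [UW WU UWK]]]|[ort surj]].
  split=> [i j|j]; first by rewrite UW WU inner_ket.
  by exists (W (ket j)).
have VU : V \o U = id.
  apply: bounded_linear_unique; [exact: bounded_linear_comp|exact: bounded_linear_id|].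
  move=> j; apply/val_inj/funext => i.
  by have := ort i j; rewrite UV inner_ketl.
have VUf f : V (U f) = f by rewrite -[RHS]/(id f) -VU.
split=> //; exists V; split=> // g; rewrite -[RHS]/(id g) -[LHS]/((U \o V) g).
congr (_ g); apply: bounded_linear_unique => //.
- exact: bounded_linear_comp.
- exact: bounded_linear_id.
by move=> j /=; have [f <-] := surj j; rewrite VUf.
Qed.

End Unitarity.

(** * The adjoint of the time evolution as a finite sum of partial shifts *)

Section Adjoint.
Local Open Scope ring_scope.
Local Open Scope complex_scope.
Context {R : realType} {A : alphabet} (M : preQTM R A).
Local Notation move := ((Q M * tsym A) * (Q M * tsym A) * dir)%type.

(** The test for a nonzero coefficient excludes the moves on which [gamma] may return its default
    value; on the others this is the partial inverse of [move_source]. *)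
Definition move_target (k : move) (C : config M) : option (config M) :=
  if (move_coef k != 0) && ((state C, scanned C) == k.1.1)
  then Some (gamma C k.1.2 k.2) else None.

Lemma move_target_source k (C D : config M) : move_coef k != 0 ->
  move_source k D = Some C <-> move_target k C = Some D.
Proof.
move=> ck; rewrite /move_target ck; split=> [/move_sourceP[<- <-]|].
  by rewrite eqxx.
by case: eqP => // sC [<-]; exact: move_source_gamma.
Qed.

Lemma move_target_inj k (C C' D : config M) :
  move_target k C = Some D -> move_target k C' = Some D -> C = C'.
Proof.
have [c0|ck] := eqVneq (move_coef k) 0; first by rewrite /move_target c0 eqxx.
by move=> /(move_target_source _ _ ck) + /(move_target_source _ _ ck) => -> [].
Qed.

Definition move_adjoint (f : l2 R (config M)) : l2 R (config M) :=
  \sum_(k : move) (move_coef k)^* *: shift (@move_target_inj k) f.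

Lemma move_adjoint_bounded : bounded_linear move_adjoint.
Proof.
split; first by apply: Defs.linear_sum => k; exact: shift_linear.
apply/sq_bounded_bounded/sq_bounded_sum => k; exact: shift_sq_bounded.
Qed.

Lemma move_adjointP : adjoint (time_evolution M) move_adjoint.
Proof.
(* Uniqueness of the bounded extension replaces the chosen operator by the explicit sum of
   shifts. *)
rewrite (bounded_extension_unique (@time_evolutionP _ _ M) (@move_sumP _ _ M)).
move=> f g; rewrite /move_sum /move_adjoint inner_suml inner_sumr.
apply: eq_bigr => k _; rewrite innerZl innerZr.
have [->|ck] := eqVneq (move_coef k) 0; first by rewrite rmorph0 !mul0r.
congr (_ * _); apply: inner_shift => D C; exact: move_target_source.
Qed.

End Adjoint.

(* Half of a tape over the plain symbols, listed from the head outwards and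
   stripped of its infinite tail of blanks. *)
Record stack (A : alphabet) := Stack
  { stack_word :> seq (tsym A);
    _ : (rstrip stack_word == stack_word) && all plain stack_word }.
HB.instance Definition _ A := [isSub for @stack_word A].
HB.instance Definition _ A := [Equality of stack A by <:].

(** * Stack operations on half tapes *)

Section Stack.
Context {A : alphabet}.
Implicit Types (a b : A) (s t : stack A).

Lemma stack_rstrip s : rstrip s = s.
Proof. by case: s => s /= /andP[/eqP]. Qed.

Lemma stack_plain s : all plain s.
Proof. by case: s => s /= /andP[]. Qed.

Lemma empty_subproof :
  (rstrip [::] == [::] :> seq (tsym A)) && all plain ([::] : seq (tsym A)).
Proof. by []. Qed.
Definition empty : stack A := Stack empty_subproof.

Lemma push_subproof a s : (rstrip (bcons (inl a) s) == bcons (inl a) s) &&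
  all plain (bcons (inl a) s).
Proof.
have e : bcons (inl a) s = rstrip (inl a :: s) by rewrite /= stack_rstrip.
by rewrite e rstripK eqxx -e all_bcons ?stack_plain.
Qed.
Definition push a s : stack A := Stack (push_subproof a s).

Lemma pop_subproof s : (rstrip (behead s) == behead s) && all plain (behead s).
Proof.
rewrite rstrip_behead ?stack_rstrip// eqxx /=.
by have := stack_plain s; case: (stack_word s) => //= a w /andP[].
Qed.
Definition pop s : stack A := Stack (pop_subproof s).

Definition top s : A := base (head tblank s).

Lemma head_stack s : head tblank s = inl (top s).
Proof.
by rewrite /top; have := stack_plain s; case: (stack_word s) => //= -[].
Qed.

Lemma top_push a s : top (push a s) = a.
Proof. by rewrite /top /= head_bcons. Qed.

Lemma pop_push a s : pop (push a s) = s.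
Proof. by apply/val_inj; rewrite /= behead_bcons. Qed.

(** This includes the empty stack: its top is the blank, and pushing a blank on it changes
    nothing. *)
Lemma push_top_pop s : push (top s) (pop s) = s.
Proof.
apply/val_inj; rewrite /= -head_stack -rstrip_head_behead//.
exact: stack_rstrip.
Qed.

Lemma eq_push a b s t : (push a s == push b t) = (a == b) && (s == t).
Proof.
apply/eqP/andP => [e|[/eqP -> /eqP ->]//].
have := congr1 top e; have := congr1 pop e.
by rewrite !top_push !pop_push => -> ->.
Qed.

Lemma pop_empty : pop empty = empty.
Proof. exact/val_inj. Qed.

(** The symbol [one] differs from the blank, so it gives tapes that stripping cannot identify. *)
Lemma push_one_neq_empty : (push (Defs.one A) empty == empty) = false.
Proof.
apply/eqP => e; have := top_push (Defs.one A) empty; rewrite e /top /=.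
by case: A => S o b /= /eqP nob /esym.
Qed.

End Stack.
Arguments empty {A}.

(** * Plain configurations and their evolution in terms of stacks *)

Section Plain.
Local Open Scope ring_scope.
Local Open Scope complex_scope.
Context {R : realType} {A : alphabet} (M : preQTM R A).
Implicit Types (l r : stack A) (p q : Q M) (C D : config M).
Local Notation U := (time_evolution M).
Local Notation src := (Q0 M :|: Qs M).
Local Notation tgt := (Q0 M :|: Qt M).

Lemma conf_subproof l q r : is_config (rev l, q, r : seq (tsym A)).
Proof.
have := @plain_config _ _ M (rev l) q r; rewrite all_rev !stack_plain.
by rewrite /lstrip revK !stack_rstrip => /(_ isT isT).
Qed.

(** Two stacks with their tops next to the head; with no barred symbol on the tape, every state is
    admissible. *)
Definition conf l q r : config M := Config (conf_subproof l q r).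

Lemma eq_conf l q r l' q' r' :
  (conf l q r == conf l' q' r') = [&& l == l', q == q' & r == r'].
Proof.
apply/eqP/and3P => [[/(can_inj revK) e1 e2 e3]|[/eqP -> /eqP -> /eqP -> //]].
by split; apply/eqP => //; exact/val_inj.
Qed.

Lemma confP C : all plain (left_word C) -> all plain (right_word C) ->
  exists l r, C = conf l (state C) r.
Proof.
move=> pl pr.
have hl : (rstrip (rev (left_word C)) == rev (left_word C)) &&
    all plain (rev (left_word C)).
  by rewrite rstrip_rev ?left_strip// eqxx all_rev.
have hr : (rstrip (right_word C) == right_word C) && all plain (right_word C).
  by rewrite right_strip eqxx.
exists (Stack hl), (Stack hr); apply/val_inj; rewrite /= revK.
by rewrite /left_word /state /right_word; case: (cval C) => -[].
Qed.

Lemma gamma_confR l q r p b :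
  gamma (conf l q r) (p, inl b) Rdir = conf (push b l) p (pop r).
Proof.
rewrite /gamma; set D := conf (push b l) _ _.
suff -> : gamma_raw (conf l q r) (p, inl b).1 (p, inl b).2 Rdir = cval D.
  exact: valKd.
rewrite /gamma_raw /left_word /right_word /= -/(rstrip _).
rewrite lstrip_rcons ?revK; last by rewrite /lstrip revK stack_rstrip.
by rewrite rstrip_behead ?stack_rstrip.
Qed.

Lemma gamma_confL l q r p b : gamma (conf l q r) (p, inl b) Ldir =
  conf (pop l) p (push (top l) (push b (pop r))).
Proof.
rewrite /gamma; set D := conf (pop l) _ _.
suff -> : gamma_raw (conf l q r) (p, inl b).1 (p, inl b).2 Ldir = cval D.
  exact: valKd.
rewrite /gamma_raw /left_word /right_word /= revK.
rewrite {1}/lstrip revK !rstrip_behead ?stack_rstrip// -head_stack.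
suff -> : last tblank (rev l) = head tblank l by [].
by case: (stack_word l) => //= a s; rewrite rev_cons last_rcons.
Qed.

Lemma conf_S_m0 l q r : q \in src ->
  (state (conf l q r), scanned (conf l q r)) \in S_ M m0.
Proof. by move=> qs; rewrite inE /= qs /scanned /right_word /= head_stack. Qed.

Lemma big_dir (V : nmodType) (F : dir -> V) : \sum_d F d = F Ldir + F Rdir.
Proof.
rewrite (bigD1 Ldir) //= (bigD1 Rdir) //= big1 ?addr0//.
by case.
Qed.

Lemma big_T_m0 (V : nmodType) (F : Q M * tsym A -> V) :
  \sum_(t in T_ M m0) F t = \sum_(p in tgt) \sum_b F (p, inl b).
Proof.
rewrite (eq_big (fun t => (t.1 \in tgt) && plain t.2)
  (fun t => F (t.1, t.2))) => [|t|[]//]; last by rewrite inE.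
rewrite -(pair_big (fun p => p \in tgt) plain (fun p v => F (p, v))) /=.
apply: eq_bigr => p _; rewrite big_sumType /= [X in _ + X]big1 ?addr0//.
Qed.

Lemma evolution_conf l q r : q \in src -> U (ket (conf l q r)) =
  \sum_(p in tgt) \sum_b
    (delta0 q (top r) p b Rdir *: ket (conf (push b l) p (pop r)) +
     delta0 q (top r) p b Ldir *:
       ket (conf (pop l) p (push (top l) (push b (pop r))))).
Proof.
move=> qs; have [_ h] := time_evolutionP M.
rewrite (h m0); last exact: conf_S_m0.
rewrite big_T_m0; apply: eq_bigr => p _; apply: eq_bigr => b _.
by rewrite big_dir gamma_confR gamma_confL addrC /scanned /right_word /= head_stack.
Qed.

End Plain.

(** * Inner products of evolved plain kets and the conditions (U1)-(U3) *)

Section Gram.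
Local Open Scope ring_scope.
Local Open Scope complex_scope.
Context {R : realType} {A : alphabet} (M : preQTM R A).
Implicit Types (l r : stack A) (p q : Q M) (C D : config M).
Local Notation U := (time_evolution M).
Local Notation src := (Q0 M :|: Qs M).
Local Notation tgt := (Q0 M :|: Qt M).

(** The sum of (U2); on the diagonal it is that of (U1). *)
Definition gram q a q' a' : R[i] := \sum_(p in tgt) \sum_(b : A) \sum_(d : dir)
  (delta0 q' a' p b d)^* * delta0 q a p b d.

(** The sum of (U3). *)
Definition cross q a b q' a' b' : R[i] :=
  \sum_(p in tgt) (delta0 q' a' p b' Ldir)^* * delta0 q a p b Rdir.

(** Two moves interfere when they end in the same configuration. Moves in equal directions do so
    only if they write the same symbol on tapes that agree off the scanned cell, which gives the
    [gram] term. The other two terms pair a left move from one configuration with a right move from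
    the other. *)
Lemma inner_conf l q r l' q' r' : q \in src -> q' \in src ->
  inner (U (ket (conf l' q' r'))) (U (ket (conf l q r))) =
  ((l' == l) && (pop r' == pop r))%:R * gram q (top r) q' (top r') +
  \sum_(b' : A) \sum_(b : A)
    ((pop l' == push b l) && (push (top l') (push b' (pop r')) == pop r))%:R *
    cross q (top r) b q' (top r') b' +
  \sum_(b' : A) \sum_(b : A)
    ((push b' l' == pop l) && (pop r' == push (top l) (push b (pop r))))%:R *
    (cross q' (top r') b' q (top r) b)^*.
Proof.
move=> qs qs'; rewrite !evolution_conf//.
set a := top r; set a' := top r'.
(* The summand left once distinct target states are seen to be orthogonal. *)
pose T p b' b : R[i] :=
  ((l' == l) && (pop r' == pop r))%:R * ((b' == b)%:R *
     ((delta0 q' a' p b' Ldir)^* * delta0 q a p b Ldir +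
      (delta0 q' a' p b' Rdir)^* * delta0 q a p b Rdir)) +
  ((pop l' == push b l) && (push (top l') (push b' (pop r')) == pop r))%:R *
    ((delta0 q' a' p b' Ldir)^* * delta0 q a p b Rdir) +
  ((push b' l' == pop l) && (pop r' == push (top l) (push b (pop r))))%:R *
    ((delta0 q' a' p b' Rdir)^* * delta0 q a p b Ldir).
transitivity (\sum_(p in tgt) \sum_b' \sum_b T p b' b).
  rewrite inner_suml; apply: eq_bigr => p' p't.
  rewrite inner_suml; apply: eq_bigr => b' _.
  rewrite inner_sumr (bigD1 p') //= [X in _ + X]big1 ?addr0; last first.
    move=> p /andP[_ /negPf ne]; rewrite inner_sumr big1// => b _.
    rewrite !innerDl !innerDr !innerZl !innerZr !inner_ket !eq_conf.
    by rewrite [p' == p]eq_sym ne ?andbF /= ?mulr0 ?addr0.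
  rewrite inner_sumr; apply: eq_bigr => b _.
  rewrite !innerDl !innerDr !innerZl !innerZr !inner_ket !eq_conf !eq_push eqxx /=.
  have -> : (pop l' == pop l) && [&& top l' == top l, b' == b & pop r' == pop r] =
     (b' == b) && ((l' == l) && (pop r' == pop r)).
    have -> : (l' == l) = (top l' == top l) && (pop l' == pop l).
      by rewrite -eq_push !push_top_pop.
    by do !case: (_ == _).
  have -> : (b' == b) && (l' == l) && (pop r' == pop r) =
     (b' == b) && ((l' == l) && (pop r' == pop r)) by rewrite andbA.
  have nb (x y : bool) : (x && y)%:R = x%:R * y%:R :> R[i].
    by rewrite -natrM mulnb.
  by rewrite /T (nb (b' == b)); ring.
rewrite /gram /cross; under eq_bigr => p _ do under eq_bigr => b' _ do
  rewrite !big_split /=.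
under eq_bigr => p _ do rewrite !big_split /=.
rewrite !big_split /=; congr (_ + _ + _).
- rewrite mulr_sumr; apply: eq_bigr => p _; rewrite mulr_sumr.
  apply: eq_bigr => b' _; rewrite (bigD1 b') //= big1 ?addr0; last first.
    by move=> b /negPf ne; rewrite [b' == b]eq_sym ne mul0r mulr0.
  by rewrite eqxx mul1r big_dir.
- rewrite exchange_big /=; apply: eq_bigr => b' _.
  rewrite exchange_big /=; apply: eq_bigr => b _.
  by rewrite mulr_sumr.
- rewrite exchange_big /=; apply: eq_bigr => b' _.
  rewrite exchange_big /=; apply: eq_bigr => b _.
  rewrite rmorph_sum mulr_sumr; apply: eq_bigr => p _.
  rewrite rmorphM; congr (_ * _); rewrite mulrC; congr (_ * _).
  exact: (esym (conjcK (delta0 q a p b Ldir))).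
Qed.

Lemma U1U2P : U1 M /\ U2 M <-> forall q a q' a', q \in src -> q' \in src ->
  gram q a q' a' = ((q, a) == (q', a'))%:R.
Proof.
have n1 q a : gram q a q a =
  \sum_(p in tgt) \sum_b \sum_d `|delta0 q a p b d| ^+ 2.
  do 3![apply: eq_bigr => ? _]; by rewrite sqr_normc mulrC.
split=> [[u1 u2] q a q' a' qs qs'|h].
  by case: eqP => [[<- <-]|ne]; [rewrite n1 u1|exact: u2].
split=> [q a qs|q a q' a' qs qs' ne]; first by rewrite -n1 h// eqxx.
by rewrite -/(gram q a q' a') h//; case: eqP.
Qed.

Lemma inner_conf_QTM l q r l' q' r' : is_QTM M -> q \in src -> q' \in src ->
  inner (U (ket (conf l' q' r'))) (U (ket (conf l q r))) =
  (conf l' q' r' == conf l q r)%:R.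
Proof.
move=> [u1 u2 u3] qs qs'; have u12 := U1U2P.1 (conj u1 u2).
rewrite inner_conf// u12//.
have c0 q1 a1 b1 q2 a2 b2 : q1 \in src -> q2 \in src ->
  cross q1 a1 b1 q2 a2 b2 = 0 by move=> ? ?; exact: u3.
rewrite [X in _ + X + _]big1 => [|b' _]; last first.
  by apply: big1 => b _; rewrite c0// mulr0.
rewrite [X in _ + X]big1 => [|b' _]; last first.
  by apply: big1 => b _; rewrite c0// rmorph0 mulr0.
rewrite !addr0 -natrM mulnb eq_conf xpair_eqE; congr (nat_of_bool _)%:R.
have -> : (r' == r) = (top r' == top r) && (pop r' == pop r).
  by rewrite -eq_push !push_top_pop.
rewrite (eq_sym q) (eq_sym (top r)).
by do !case: (_ == _).
Qed.

(* The words are chosen so that the two configurations have exactly one common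
   successor tape, reached by a right move from the first and by a left move
   from the second. *)
Lemma ket_isometry_U3 :
  (forall C D, inner (U (ket C)) (U (ket D)) = (C == D)%:R) -> U3 M.
Proof.
move=> iso q a b q' a' b' qs qs'.
set e := @empty A; set l := push (Defs.one A) e.
have le : (l == e) = false by exact: push_one_neq_empty.
have pe c s : (push c s == e) -> s = e.
  by move/eqP => h; rewrite -(pop_push c s) h pop_empty.
have ne : (push (Defs.one A) (push b l) == l) = false.
  apply/negP => /eqP h; have := pop_push (Defs.one A) (push b l).
  rewrite h pop_push => /esym/eqP/pe h'; by rewrite h' eqxx in le.
have := inner_conf l (push a (push (Defs.one A) (push b' e)))
  (push (Defs.one A) (push b l)) (push a' e) qs qs'.
rewrite iso eq_conf ne /= mul0r add0r !top_push !pop_push.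
rewrite (bigD1 b') //= (bigD1 b) //= !eqxx mul1r.
rewrite big1 ?addr0 => [|c /negPf nc]; last first.
  by rewrite eq_push [b == c]eq_sym nc mul0r.
rewrite big1 ?addr0 => [|c' /negPf nc]; last first.
  by apply: big1 => c _; rewrite !eq_push nc andbF andbF mul0r.
(* The opposite overlap would make a stack built by pushing on [l] empty; [pe] peels this down to
   [l = e]. *)
rewrite big1 ?addr0 => [/esym//|c' _]; apply: big1 => c _.
case: eqP => [/eqP/pe /eqP/pe h|_]; last by rewrite mul0r.
by move/eqP: h => /pe h; rewrite h eqxx in le.
Qed.

(** Once (U3) has removed the mixed terms, two configurations with an empty left stack that differ
    at most in state and scanned symbol have [gram] as their overlap. *)
Lemma ket_isometry_QTM :
  (forall C D, inner (U (ket C)) (U (ket D)) = (C == D)%:R) -> is_QTM M.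
Proof.
move=> iso; have u3 := ket_isometry_U3 iso.
suff /U1U2P[] : forall q a q' a', q \in src -> q' \in src ->
  gram q a q' a' = ((q, a) == (q', a'))%:R by [].
move=> q a q' a' qs qs'.
have c0 q1 a1 b1 q2 a2 b2 : q1 \in src -> q2 \in src ->
  cross q1 a1 b1 q2 a2 b2 = 0 by move=> ? ?; exact: u3.
have := inner_conf empty (push a empty) empty (push a' empty) qs qs'.
rewrite [X in _ + X + _]big1 => [|b' _]; last first.
  by apply: big1 => b _; rewrite c0// mulr0.
rewrite [X in _ + X]big1 => [|b' _]; last first.
  by apply: big1 => b _; rewrite c0// rmorph0 mulr0.
rewrite iso eq_conf !pop_push !top_push !eqxx /= mul1r !addr0 eq_push eqxx andbT.
by rewrite xpair_eqE (eq_sym q') (eq_sym a').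
Qed.

End Gram.

(** * Moves on barred symbols and from final states; orthonormality of all images *)

Section Evolution.
Local Open Scope ring_scope.
Local Open Scope complex_scope.
Context {R : realType} {A : alphabet} (M : preQTM R A).
Implicit Types (l r : stack A) (p q : Q M) (C D : config M).
Local Notation U := (time_evolution M).
Local Notation src := (Q0 M :|: Qs M).
Local Notation tgt := (Q0 M :|: Qt M).

Lemma l2_sum_condE (I : choiceType) (T : Type) (s : seq T) (P : pred T)
    (F : T -> l2 R I) j :
  (\sum_(i <- s | P i) F i) j = \sum_(i <- s | P i) F i j.
Proof. by elim/big_rec2 : _ => [|i x y _ <-]. Qed.

Lemma tgt_notin_Qs p : p \in tgt -> p \notin Qs M.
Proof.
rewrite !inE => /orP[/norP[]//|pt]; apply/negP => ps; exact: QsQt ps pt.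
Qed.

Lemma conf_m0 C : (state C, scanned C) \in S_ M m0 ->
  exists l q r, C = conf l q r /\ q \in src.
Proof.
move=> sC; have [pl pr] := state_scanned sC.
have [l [r ->]] := confP pl pr; exists l, (state C), r; split=> //.
by move: sC; rewrite inE => /andP[].
Qed.

Definition toggle_bar (u : tsym A) : tsym A :=
  match u with inl a => inr a | inr a => inl a end.

(** In these modes [delta_] is the indicator of a single right move, which toggles the bar of the
    scanned symbol. *)
Lemma evolution_ms_mt x C : (state C, scanned C) \in S_ M x -> x <> m0 ->
  exists2 D, U (ket C) = ket D &
    cval D = gamma_raw C (state C) (toggle_bar (scanned C)) Rdir.
Proof.
move=> sC xn0; pose t : Q M * tsym A := (state C, toggle_bar (scanned C)).
have dE t1 d1 : delta_ x (state C, scanned C) t1 d1 =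
    ((t1, d1) == (t, Rdir))%:R :> R[i].
  case: x sC xn0 => //= + _; rewrite !inE /barred /t /=;
    by case: (scanned C) => [a|a]; rewrite /= ?andbF.
have tT : t \in T_ M x.
  case: x sC xn0 {dE} => //= + _; rewrite !inE /barred /t /=;
    by case: (scanned C) => [a|a]; rewrite /= ?andbF.
exists (gamma C t Rdir); last first.
  by rewrite (gammaE sC tT)// dE eqxx oner_eq0.
have [_ h] := time_evolutionP M; rewrite (h x)//.
rewrite (bigD1 t) //= [X in _ + X]big1 ?addr0; last first.
  move=> t1 /andP[_ /negPf ne]; apply: big1 => d _.
  by rewrite dE xpair_eqE ne scale0r.
have LR : (Ldir == Rdir) = false by [].
by rewrite big_dir !dE !xpair_eqE LR !eqxx /= scale0r add0r scale1r.
Qed.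

(** The only mode that can lead to [D]: moves of mode [m0] never enter [Qs] and leave a plain tape,
    those of mode [ms] stay in [Qs], and those of mode [mt] leave a barred symbol to the left of the
    head. *)
Definition target_mode D : mode :=
  if state D \in Qs M then ms else if all plain (left_word D) then m0 else mt.

Lemma evolution_support x C D : (state C, scanned C) \in S_ M x ->
  target_mode D <> x -> U (ket C) D = 0.
Proof.
move=> sC nx; have [x0|xn0] := pselect (x = m0).
  move: sC nx; rewrite x0 => /conf_m0[l [q [r [-> qs]]]] nx.
  have k0 l1 p r1 : p \in tgt -> (ket (conf l1 p r1) : l2 R _) D = 0.
    move=> /tgt_notin_Qs/negPf pt /=; rewrite /ket_fun; case: eqP => // e.
    case: nx; rewrite e /target_mode /state /= pt /left_word /= all_rev.
    by rewrite stack_plain.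
  rewrite evolution_conf// l2_sum_condE big1 // => p pt.
  rewrite l2_sum_condE big1// => b _.
  have l2D (f g : l2 R (config M)) : (f + g) D = f D + g D by [].
  by rewrite l2D !l2ZE !k0// !mulr0 addr0.
have [E -> vE] := evolution_ms_mt sC xn0.
rewrite /= /ket_fun; case: eqP => // e; case: nx; rewrite e /target_mode.
have -> : state E = state C by rewrite /state vE.
have lE : left_word E = rev (bcons (toggle_bar (scanned C)) (rev (left_word C))).
  by rewrite /left_word vE /= lstrip_rcons// left_strip.
case: x sC xn0 {vE e} => //= + _; rewrite !inE /= => /andP[qx ux].
  by rewrite qx.
have -> : (state C \in Qs M) = false by apply/negP => /QsQt/(_ qx).
by rewrite lE all_rev; case: (scanned C) ux.
Qed.

(** The symbol just written determines the one that was scanned, and then the move can be undone. *)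
Lemma evolution_inj x C C' : x <> m0 -> (state C, scanned C) \in S_ M x ->
  (state C', scanned C') \in S_ M x -> U (ket C) = U (ket C') -> C = C'.
Proof.
move=> xn0 sC sC'.
have [D -> vD] := evolution_ms_mt sC xn0.
have [D' -> vD'] := evolution_ms_mt sC' xn0.
move=> /(congr1 (fun f : l2 R _ => f D)) /=; rewrite /ket_fun eqxx.
case: eqP => [e _|_ /eqP]; last by rewrite oner_eq0.
move: vD'; rewrite -e vD => {}e.
have es : scanned C = scanned C'.
  move: e => -[+ _ _]; rewrite !lstrip_rcons ?left_strip//.
  move=> /(can_inj revK)/bcons_inj[+ _].
  by case: (scanned C) => a; case: (scanned C') => b //= [->].
have eq : state C = state C' by move: e => -[_ -> _].
by move: e; rewrite -es -eq; exact: gamma_raw_inj.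
Qed.

(** Different modes have images with disjoint supports. Within [m0] the local conditions apply;
    within another mode the evolution is injective from kets to kets. *)
Lemma QTM_isometry : is_QTM M ->
  forall C D, inner (U (ket C)) (U (ket D)) = (C == D)%:R.
Proof.
move=> qtm C D; have [x sC] := S_cover C; have [y sD] := S_cover D.
have [exy|nxy] := pselect (x = y); last first.
  rewrite inner_disjoint.
    case: eqP => // e; case: nxy; move: sD; rewrite -e => sD.
    exact: S_disjoint sC sD.
  move=> E; have [eE|nE] := pselect (target_mode E = x).
    right; apply: (evolution_support sD) => e; apply: nxy.
    by rewrite -eE -e.
  by left; exact: (evolution_support sC).
rewrite -exy in sD; have [x0|xn0] := pselect (x = m0).
  move: sC sD; rewrite x0 => /conf_m0[l [q [r [-> qs]]]].
  move=> /conf_m0[l' [q' [r' [-> qs']]]]; exact: inner_conf_QTM.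
have inj := evolution_inj xn0 sC sD.
have [E eE _] := evolution_ms_mt sC xn0.
have [E' eE' _] := evolution_ms_mt sD xn0.
rewrite eE eE' in inj *; rewrite inner_ket; congr (nat_of_bool _)%:R.
apply/eqP/eqP => [e|e]; first by apply: inj; rewrite e.
have : ket E = ket E' :> l2 R _ by rewrite -eE -eE' e.
move=> /(congr1 (fun f : l2 R _ => f E)) /=; rewrite /ket_fun eqxx.
by case: eqP => // _ /eqP; rewrite oner_eq0.
Qed.

End Evolution.

(** * Every ket is an image *)

Section Surjectivity.
Local Open Scope ring_scope.
Local Open Scope complex_scope.
Context {R : realType} {A : alphabet} (M : preQTM R A).
Implicit Types (l r : stack A) (p q : Q M) (C D : config M).
Local Notation U := (time_evolution M).
Local Notation src := (Q0 M :|: Qs M).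
Local Notation tgt := (Q0 M :|: Qt M).

Lemma evolution_ket_onto x al (q : Q M) be D :
  is_config (al, q, be) -> (q, head tblank be) \in S_ M x -> x <> m0 ->
  cval D = (lstrip (rcons al (toggle_bar (head tblank be))), q,
            rstrip (behead be)) ->
  exists f, U f = ket D.
Proof.
move=> cC sC xn0 vD; exists (ket (Config cC)).
have [E -> vE] := @evolution_ms_mt _ _ M x (Config cC) sC xn0.
by congr ket; apply/val_inj; rewrite -[LHS]/(cval E) vE -[RHS]/(cval D) vD.
Qed.

(** The predecessor is found by moving the head back left and barring the symbol found there, a
    blank if the left word is empty. *)
Lemma evolution_onto_Qs D : state D \in Qs M -> exists f, U f = ket D.
Proof.
move=> qs; have /and5P[/eqP hl /eqP hr _] := configP D.
rewrite qs /= => /andP[pl pr] _; set q := state D in qs *.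
pose s := rev (left_word D).
have sE : s = bcons (head tblank s) (behead s).
  by apply: rstrip_head_behead; exact: rstrip_rev.
have ps : all plain s by rewrite all_rev.
have hs : head tblank s = inl (base (head tblank s)).
  by case: (s) ps => //= -[].
set a := base _ in hs.
have rb : rstrip (behead s) = behead s by apply/rstrip_behead/rstrip_rev.
have nb : bcons (inr a) (right_word D) = inr a :: right_word D by [].
have lb : lstrip (rev (behead s)) = rev (behead s) by rewrite /lstrip revK rb.
apply: (@evolution_ket_onto ms (rev (behead s)) q (inr a :: right_word D)) => //.
- rewrite /is_config lb /= hr nb !eqxx /= qs.
  have -> : (q \in Q0 M) = false by rewrite !inE qs.
  have -> : (q \in Qt M) = false by apply/negP; exact: QsQt.
  rewrite /= andbT all_rev; apply/andP; split.
    by case: (s) ps => //= ? ? /andP[].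
  by rewrite eqseq_cons eqxx.
- by rewrite inE /= qs.
rewrite /= lstrip_rcons// revK -hs -sE revK hr.
by rewrite /q /left_word /state /right_word; case: (cval D) => -[].
Qed.

(** Here the head moves back left and the bar of the symbol found there is removed. *)
Lemma evolution_onto_bar D : state D \in Qt M -> ~~ all plain (left_word D) ->
  exists f, U f = ket D.
Proof.
move=> qt nl; have /and5P[/eqP hl /eqP hr _ _] := configP D.
rewrite qt /= => /andP[pr pl]; set q := state D in qt *.
pose s := rev (left_word D).
have sE : s = bcons (head tblank s) (behead s).
  by apply: rstrip_head_behead; exact: rstrip_rev.
have {}pl : s == [seq a <- s | barred a] ++ [seq a <- s | plain a].
  by rewrite /s !filter_rev -rev_cat (inj_eq (can_inj revK)).
have {}nl : ~~ all plain s by rewrite all_rev.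
have rb : rstrip (behead s) = behead s by apply/rstrip_behead/rstrip_rev.
(* Read from the head, the left word has its barred symbols first; as it is not plain, it starts
   with one. *)
have [a hs pl'] : exists2 a, head tblank s = inr a & behead s ==
    [seq b <- behead s | barred b] ++ [seq b <- behead s | plain b].
  case: (s) pl nl {sE rb} => //= -[a|a] w /=; last first.
    by rewrite eqseq_cons eqxx /= => h _; exists a.
  case E: [seq b <- w | barred b] => [|b t] /= h nw.
    move: h; rewrite eqseq_cons eqxx /= => /eqP h.
    by move: nw; rewrite h filter_all.
  have : b \in [seq b <- w | barred b] by rewrite E mem_head.
  by move: h; rewrite eqseq_cons => /andP[/eqP <- _]; rewrite mem_filter.
have lb : lstrip (rev (behead s)) = rev (behead s) by rewrite /lstrip revK rb.
have rE : rstrip (bcons (inl a) (right_word D)) = bcons (inl a) (right_word D).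
  have e : bcons (inl a) (right_word D) = rstrip (inl a :: right_word D).
    by rewrite /= hr.
  by rewrite e rstripK.
apply: (@evolution_ket_onto mt (rev (behead s)) q (bcons (inl a) (right_word D))) => //.
- rewrite /is_config lb rE !eqxx /= qt.
  have -> : (q \in Q0 M) = false by rewrite !inE qt orbT.
  have -> : (q \in Qs M) = false by apply/negP => /QsQt/(_ qt).
  rewrite /= all_bcons//= !filter_rev -rev_cat (inj_eq (can_inj revK)) //.
- by rewrite inE /= qt head_bcons.
rewrite head_bcons behead_bcons /= lstrip_rcons// revK -hs -sE revK hr.
by rewrite /q /left_word /state /right_word; case: (cval D) => -[].
Qed.

Lemma card_target_source : (#|Qt M| <= #|Qs M|)%N -> (#|tgt| <= #|src|)%N.
Proof.
move=> le; apply: leq_trans (leq_card_setU _ _) _.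
have : [disjoint Q0 M & Qs M].
  rewrite -setI_eq0; apply/eqP/setP => q; rewrite !inE.
  by case: (q \in Qs M); rewrite ?andbF.
by rewrite -(geq_leqif (leq_card_setU _ _)) => /(leq_trans _); apply; rewrite leq_add2l.
Qed.

(** Regroups the image of a superposition by target, so that its coefficients are the column sums of
    [column_completeness]. *)
Lemma sum_scale_exchange (I : choiceType) (T P B : finType) (X : {set T})
    (Y : {set P}) (c : T -> R[i]) (dR dL : T -> P -> B -> R[i])
    (kR kL : P -> B -> l2 R I) :
  \sum_(s in X) c s *: (\sum_(p in Y) \sum_b
     (dR s p b *: kR p b + dL s p b *: kL p b)) =
  \sum_(p in Y) \sum_b ((\sum_(s in X) c s * dR s p b) *: kR p b +
     (\sum_(s in X) c s * dL s p b) *: kL p b).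
Proof.
under eq_bigr => s _ do rewrite scaler_sumr.
rewrite exchange_big /=; apply: eq_bigr => p _.
under eq_bigr => s _ do rewrite scaler_sumr.
rewrite exchange_big /=; apply: eq_bigr => b _.
rewrite !scaler_suml -big_split /=; apply: eq_bigr => s _.
by rewrite scalerDr !scalerA.
Qed.

Lemma evolution_onto_plain l p r : (#|Qt M| <= #|Qs M|)%N -> is_QTM M ->
  p \in tgt -> exists f, U f = ket (conf l p r).
Proof.
move=> cardQ [u1 u2 u3] pt; have u12 := (U1U2P M).1 (conj u1 u2).
pose X := [set s : Q M * A | s.1 \in src].
pose dR (s : Q M * A) p1 (b1 : A) : R[i] := delta0 s.1 s.2 p1 b1 Rdir.
pose dL (s : Q M * A) p1 (b1 : A) : R[i] := delta0 s.1 s.2 p1 b1 Ldir.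
have orth s s' : s \in X -> s' \in X -> \sum_(p1 in tgt) \sum_b1
    ((dR s' p1 b1)^* * dR s p1 b1 + (dL s' p1 b1)^* * dL s p1 b1) =
    (s == s')%:R.
  rewrite !inE => sX sX'; have := u12 s.1 s.2 s'.1 s'.2.
  rewrite !inE -!surjective_pairing => /(_ sX sX') <-.
  by do 2![apply: eq_bigr => ? _]; rewrite big_dir addrC.
have crs s s' b b' : s \in X -> s' \in X ->
    \sum_(p1 in tgt) (dL s' p1 b')^* * dR s p1 b = 0.
  rewrite [s \in X]inE [s' \in X]inE => sX sX'.
  exact: (u3 s.1 s.2 b s'.1 s'.2 b').
have card : (#|tgt| * #|A| <= #|X|)%N.
  have -> : X = finset.setX src [set: A]%SET by apply/finset.setP => s; rewrite !inE andbT.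
  by rewrite cardsX cardsT leq_mul2r card_target_source ?orbT.
have [e1 e2 e3 e4 e5] := column_completeness (C := R[i]) orth crs card
  (top l) (top (pop r)) pt.
have lU : linear U by have [[]] := time_evolutionP M.
(* From these a right move writing [top l] leads to the tape [l], [r]. *)
pose xR : l2 R (config M) := \sum_(s in X) (dR s p (top l))^* *:
  ket (conf (pop l) s.1 (push s.2 r)).
(* From these a left move does: it writes [top (pop r)] and steps back onto [top r], which lies on
   top of the left stack. *)
pose xL : l2 R (config M) := \sum_(s in X) (dL s p (top (pop r)))^* *:
  ket (conf (push (top r) l) s.1 (push s.2 (pop (pop r)))).
exists (1 *: xR + xL); rewrite lU scale1r /xR /xL !(linear_sumZ _ _ _ _ lU).
have ER : \sum_(s in X) (dR s p (top l))^* *: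
    U (ket (conf (pop l) s.1 (push s.2 r))) =
    \sum_(p1 in tgt) (\sum_(s in X) (dR s p (top l))^* * dR s p1 (top l)) *:
      ket (conf l p1 r).
  under eq_bigr => s sX.
    rewrite evolution_conf; last by move: sX; rewrite inE.
    rewrite top_push pop_push. over.
  rewrite (sum_scale_exchange _ _ _ dR dL); apply: eq_bigr => p1 p1t.
  rewrite (bigD1 (top l)) //= [X in _ + X = _]big1 => [|b1 nb1].
    by rewrite e3// scale0r !addr0 push_top_pop.
  by rewrite e2// e3// !scale0r addr0.
have EL : \sum_(s in X) (dL s p (top (pop r)))^* *:
    U (ket (conf (push (top r) l) s.1 (push s.2 (pop (pop r))))) =
    \sum_(p1 in tgt) (\sum_(s in X) (dL s p (top (pop r)))^* *
      dL s p1 (top (pop r))) *: ket (conf l p1 r).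
  under eq_bigr => s sX.
    rewrite evolution_conf; last by move: sX; rewrite inE.
    rewrite !top_push !pop_push. over.
  rewrite (sum_scale_exchange _ _ _ dR dL); apply: eq_bigr => p1 p1t.
  rewrite (bigD1 (top (pop r))) //= [X in _ + X = _]big1 => [|b1 nb1].
    by rewrite e4// scale0r add0r addr0 !push_top_pop.
  by rewrite e4// e5// !scale0r addr0.
(* Both parts now live on the target tape, where [e1] makes their coefficients add up to the
   indicator of [p]. *)
rewrite ER EL -big_split /= (bigD1 p) //= [X in _ + X = _]big1 => [|p1 /andP[p1t /negPf ne]].
  by rewrite -scalerDl e1// eqxx scale1r addr0.
by rewrite -scalerDl e1// ne scale0r.
Qed.

(** Final states need both constructions: a plain left word is reached by plain moves, one with bars
    by a barring move. *)
Lemma evolution_onto_ket D : (#|Qt M| <= #|Qs M|)%N -> is_QTM M ->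
  exists f, U f = ket D.
Proof.
move=> cardQ qtm; have [qs|nqs] := boolP (state D \in Qs M).
  exact: evolution_onto_Qs.
have /and5P[_ _ h0 _ ht] := configP D.
have [qt|nqt] := boolP (state D \in Qt M).
  have [pl|npl] := boolP (all plain (left_word D)); last exact: evolution_onto_bar.
  have [l [r ->]] : exists l r, D = conf l (state D) r.
    by apply: confP => //; move: ht; rewrite qt => /andP[].
  by apply: evolution_onto_plain => //; rewrite !inE qt orbT.
have q0 : state D \in Q0 M by rewrite !inE negb_or nqs.
have [l [r ->]] : exists l r, D = conf l (state D) r.
  by apply: confP; move: h0; rewrite q0 all_cat => /andP[].
by apply: evolution_onto_plain => //; rewrite finset.inE q0.
Qed.

End Surjectivity.

(* #|Qt M| <= #|Qs M| is not in the source; without it the equivalence fails: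
   take Q = {qi, qf, qg}, Qs = {qi}, Qt = {qf, qg} and delta0 qi a = |qf, a, R>.
   Then (U1)-(U3) hold, but no configuration evolves to <empty, qg, empty>. *)
Theorem mainTheorem9 (R : realType) (A : alphabet) (M : preQTM R A)
    (cardQ : (#|Qt M| <= #|Qs M|)%N) :
  is_QTM M <-> unitary (time_evolution M).
Proof.
have [bU _] := time_evolutionP M.
have UP := unitary_ketP bU (move_adjoint_bounded M) (@move_adjointP _ _ M).
split=> [qtm|/UP[iso _]]; last exact: ket_isometry_QTM.
apply/UP; split; first exact: QTM_isometry.
by move=> D; exact: evolution_onto_ket.
Qed.
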